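(* Let $\alpha\in(0,1)$, $\beta>0$, $a<b$, $x_a,x_b\in\mathbb R$, and $L(t,x,v,w,z)$, $l(t,x,v,w)$ real $C^1$ functions. For $x\in\mathcal F([a,b];\mathbb R)$ let $\{x\}(t)=(t,x(t),{^C_aD_t^\alpha}x(t),{_aI_t^\beta}x(t))$, $z(t)=\int_a^t l\{x\}(\tau)d\tau$, $[x](t)=(t,x(t),{^C_aD_t^\alpha}x(t),{_aI_t^\beta}x(t),z(t))$ and $J[x]=\int_a^b L[x](t)dt$. Let $x\in\mathcal F([a,b];\mathbb R)$ satisfy $x(a)=x_a$, $x(b)=x_b$ and, for all $t\in[a,b]$, \begin{multline*} \frac{\partial L}{\partial x}[x](t)+{_tD^\alpha_b}\left(\frac{\partial L}{\partial v}[x](t)\right)+{_tI_b^\beta}\left(\frac{\partial L}{\partial w}[x](t)\right)+\int_t^b\frac{\partial L}{\partial z}[x](\tau)d\tau\cdot\frac{\partial l}{\partial x}\{x\}(t)\\ +{_tD^\alpha_b}\left(\int_t^b\frac{\partial L}{\partial z}[x](\tau)d\tau\cdot\frac{\partial l}{\partial v}\{x\}(t)\right)+{_tI^\beta_b}\left(\int_t^b\frac{\partial L}{\partial z}[x](\tau)d\tau\cdot\frac{\partial l}{\partial w}\{x\}(t)\right)=0. \end{multline*} Assume $L$ is convex in $(x,v,w,z)$. If either (1) $l$ is convex in $(x,v,w)$ and $\frac{\partial L}{\partial z}[x](t)\ge0$ for all $t\in[a,b]$, or (2) $l$ is concave in $(x,v,w)$ and $\frac{\partial L}{\partial z}[x](t)\le0$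 for all $t\in[a,b]$, then $x$ is a global minimizer of $J$ on $\mathcal F([a,b];\mathbb R)$ subject to $x(a)=x_a$, $x(b)=x_b$.
   Context: $\mathcal F([a,b];\mathbb R)$: absolutely continuous $x:[a,b]\to\mathbb R$ with ${^C_aD_t^\alpha}x$ and ${_aI_t^\beta}x$ existing and continuous on $[a,b]$. ${_aI_t^\beta}x(t)=\frac{1}{\Gamma(\beta)}\int_a^t(t-\tau)^{\beta-1}x(\tau)d\tau$, ${_tI_b^\beta}x(t)=\frac{1}{\Gamma(\beta)}\int_t^b(\tau-t)^{\beta-1}x(\tau)d\tau$, ${^C_aD_t^\alpha}x(t)=\frac{1}{\Gamma(1-\alpha)}\int_a^t(t-\tau)^{-\alpha}\dot x(\tau)d\tau$, ${_tD_b^\alpha}x(t)=-\frac{1}{\Gamma(1-\alpha)}\frac{d}{dt}\int_t^b(\tau-t)^{-\alpha}x(\tau)d\tau$. A $C^1$ function $\Psi(t_1,\ldots,t_n)$ is convex (concave) in $(t_k,\ldots,t_n)$ if $\Psi(t_1+\theta_1,\ldots,t_n+\theta_n)-\Psi(t_1,\ldots,t_n)\ge(\le)\sum_{i=k}^n\frac{\partial\Psi}{\partial t_i}(t_1,\ldots,t_n)\theta_i$ for all admissible points. *)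

(* Defs.v *)
From HB Require Import structures.
From mathcomp Require Import all_boot all_order all_algebra.
From mathcomp Require Import all_classical all_reals all_analysis.
Set Implicit Arguments. Unset Strict Implicit. Unset Printing Implicit Defensive.
Import Order.TTheory GRing.Theory Num.Theory.
Import numFieldNormedType.Exports.
Local Open Scope classical_set_scope.
Local Open Scope ring_scope.

Section FracCalc.
Variable R : realType.
Local Notation mu := (@lebesgue_measure R).

Definition Gamma (s : R) : R :=
  \int[mu]_(t in `]0, +oo[) (t `^ (s - 1) * expR (- t)).

Definition fracIl (beta a : R) (x : R -> R) (t : R) : R :=
  (Gamma beta)^-1 * \int[mu]_(tau in `[a, t]) ((t - tau) `^ (beta - 1) * x tau).

Definition fracIr (beta b : R) (x : R -> R) (t : R) : R :=
  (Gamma beta)^-1 * \int[mu]_(tau in `[t, b]) ((tau - t) `^ (beta - 1) * x tau).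

Definition caputo_kernel (alpha : R) (x : R -> R) (t tau : R) : R :=
  (t - tau) `^ (- alpha) * derive1 x tau.

Definition caputoD (alpha a : R) (x : R -> R) (t : R) : R :=
  (Gamma (1 - alpha))^-1 * \int[mu]_(tau in `[a, t]) caputo_kernel alpha x t tau.

Definition rRL_aux (alpha b : R) (x : R -> R) (s : R) : R :=
  \int[mu]_(tau in `[s, b]) ((tau - s) `^ (- alpha) * x tau).

Definition rRLD (alpha b : R) (x : R -> R) (t : R) : R :=
  - ((Gamma (1 - alpha))^-1 * derive1 (rRL_aux alpha b x) t).

Definition abs_cont_on (a b : R) (x : R -> R) : Prop :=
  forall e : R, 0 < e -> exists2 d : R, 0 < d &
    forall (n : nat) (u v : 'I_n -> R),
      (forall i, a <= u i /\ u i <= v i /\ v i <= b) ->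
      (forall i j, i != j -> v i <= u j \/ v j <= u i) ->
      \sum_(i < n) (v i - u i) < d ->
      \sum_(i < n) `|x (v i) - x (u i)| < e.

Definition classF (alpha beta a b : R) (x : R -> R) : Prop :=
  [/\ abs_cont_on a b x,
      (forall t, a <= t <= b ->
         mu.-integrable `[a, t] (EFin \o caputo_kernel alpha x t)),
      {within `[a, b], continuous (caputoD alpha a x)},
      (forall t, a <= t <= b ->
         mu.-integrable `[a, t] (EFin \o (fun tau => (t - tau) `^ (beta - 1) * x tau))) &
      {within `[a, b], continuous (fracIl beta a x)}].

Definition dL1 (L : R -> R -> R -> R -> R -> R) t x v w z := derive1 (fun s => L s x v w z) t.
Definition dL2 (L : R -> R -> R -> R -> R -> R) t x v w z := derive1 (fun s => L t s v w z) x.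
Definition dL3 (L : R -> R -> R -> R -> R -> R) t x v w z := derive1 (fun s => L t x s w z) v.
Definition dL4 (L : R -> R -> R -> R -> R -> R) t x v w z := derive1 (fun s => L t x v s z) w.
Definition dL5 (L : R -> R -> R -> R -> R -> R) t x v w z := derive1 (fun s => L t x v w s) z.

Definition dl1 (l : R -> R -> R -> R -> R) t x v w := derive1 (fun s => l s x v w) t.
Definition dl2 (l : R -> R -> R -> R -> R) t x v w := derive1 (fun s => l t s v w) x.
Definition dl3 (l : R -> R -> R -> R -> R) t x v w := derive1 (fun s => l t x s w) v.
Definition dl4 (l : R -> R -> R -> R -> R) t x v w := derive1 (fun s => l t x v s) w.

Definition unc5 (F : R -> R -> R -> R -> R -> R) : R * R * R * R * R -> R :=
  fun p => F p.1.1.1.1 p.1.1.1.2 p.1.1.2 p.1.2 p.2.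
Definition unc4 (F : R -> R -> R -> R -> R) : R * R * R * R -> R :=
  fun p => F p.1.1.1 p.1.1.2 p.1.2 p.2.

Definition C1_5 (L : R -> R -> R -> R -> R -> R) : Prop :=
  (forall t x v w z,
    [/\ derivable (fun s => L s x v w z) t 1, derivable (fun s => L t s v w z) x 1,
        derivable (fun s => L t x s w z) v 1, derivable (fun s => L t x v s z) w 1 &
        derivable (fun s => L t x v w s) z 1]) /\
  continuous (unc5 L) /\ [/\ continuous (unc5 (dL1 L)), continuous (unc5 (dL2 L)),
      continuous (unc5 (dL3 L)), continuous (unc5 (dL4 L)) & continuous (unc5 (dL5 L))].

Definition C1_4 (l : R -> R -> R -> R -> R) : Prop :=
  (forall t x v w,
    [/\ derivable (fun s => l s x v w) t 1, derivable (fun s => l t s v w) x 1,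
        derivable (fun s => l t x s w) v 1 & derivable (fun s => l t x v s) w 1]) /\
  [/\ continuous (unc4 l), continuous (unc4 (dl1 l)), continuous (unc4 (dl2 l)),
      continuous (unc4 (dl3 l)) & continuous (unc4 (dl4 l))].

Definition convex_L_xvwz (L : R -> R -> R -> R -> R -> R) : Prop :=
  forall t x v w z hx hv hw hz,
    L t (x + hx) (v + hv) (w + hw) (z + hz) - L t x v w z >=
    dL2 L t x v w z * hx + dL3 L t x v w z * hv + dL4 L t x v w z * hw
    + dL5 L t x v w z * hz.

Definition convex_l_xvw (l : R -> R -> R -> R -> R) : Prop :=
  forall t x v w hx hv hw,
    l t (x + hx) (v + hv) (w + hw) - l t x v w >=
    dl2 l t x v w * hx + dl3 l t x v w * hv + dl4 l t x v w * hw.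
Definition concave_l_xvw (l : R -> R -> R -> R -> R) : Prop :=
  forall t x v w hx hv hw,
    l t (x + hx) (v + hv) (w + hw) - l t x v w <=
    dl2 l t x v w * hx + dl3 l t x v w * hv + dl4 l t x v w * hw.

Definition zfun (alpha beta a : R) (l : R -> R -> R -> R -> R) (x : R -> R) (t : R) : R :=
  \int[mu]_(tau in `[a, t])
     l tau (x tau) (caputoD alpha a x tau) (fracIl beta a x tau).

Definition along5 (alpha beta a : R) (l : R -> R -> R -> R -> R)
  (F : R -> R -> R -> R -> R -> R) (x : R -> R) (t : R) : R :=
  F t (x t) (caputoD alpha a x t) (fracIl beta a x t) (zfun alpha beta a l x t).

Definition along4 (alpha beta a : R) (F : R -> R -> R -> R -> R) (x : R -> R) (t : R) : R :=
  F t (x t) (caputoD alpha a x t) (fracIl beta a x t).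

Definition Jfun (alpha beta a b : R) (L : R -> R -> R -> R -> R -> R)
  (l : R -> R -> R -> R -> R) (x : R -> R) : R :=
  \int[mu]_(t in `[a, b]) along5 alpha beta a l L x t.

End FracCalc.

(* Main.v *)
(* With eta = y - x, convexity bounds J[y] - J[x] from below by the first
   variation of J at x in the direction eta. In the term containing dL/dz, the
   increment of z is itself bounded by the linearization of l, in the direction
   prescribed by the sign of dL/dz, and Fubini on the triangle s <= t moves the
   integral onto the weight P. Fubini again moves the fractional integral onto
   dL/dw + P dl/dw and the kernel of the Caputo derivative onto
   dL/dv + P dl/dv.

   The remaining term is the integral of eta' R, where R is the right fractional
   potential of dL/dv + P dl/dv. The Euler-Lagrange equation identifies R', up
   to the factor 1/Gamma(1 - alpha), with a function which is continuous up to
   the end points, so R can be integrated by parts against the absolutely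
   continuous eta, which vanishes at a and b; the first variation is then the
   integral of eta times the left-hand side of the equation, namely 0.

   That eta is a primitive of its almost everywhere derivative follows from the
   Jordan decomposition: a nondecreasing absolutely continuous function has a
   Lebesgue-Stieltjes measure dominated by the Lebesgue measure, hence a
   Radon-Nikodym density, which is its derivative at every Lebesgue point. *)
Require Import Defs.
From HB Require Import structures.
From mathcomp Require Import all_boot all_order all_algebra.
From mathcomp Require Import finmap.
From mathcomp Require Import all_classical all_reals all_analysis.
From mathcomp Require Import measurable_realfun.
From mathcomp Require Import lra ring.
Import Order.TTheory GRing.Theory Num.Theory.
Import numFieldNormedType.Exports.
Set Implicit Arguments. Unset Strict Implicit. Unset Printing Implicit Defensive.
Local Open Scope classical_set_scope.
Local Open Scope ring_scope.

(** * Absolutely continuous functions are primitives of their derivatives *)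

Section IntervalFamilies.
Variable R : realType.
Implicit Types (a b u v d e : R) (x : R -> R) (p q : R * R) (s t : seq (R * R)).

Definition nonoverlapping p q := (p.2 <= q.1) || (q.2 <= p.1).

Definition itv_family a b s :=
  all (fun p => [&& a <= p.1, p.1 <= p.2 & p.2 <= b]) s &&
  pairwise nonoverlapping s.

Definition family_length s := \sum_(p <- s) (p.2 - p.1).
Definition family_variation x s := \sum_(p <- s) `|x p.2 - x p.1|.

(** Sequences of pairs, unlike indexed families, can be concatenated and refined by induction. The
    non-strict bound on the variation survives a supremum over partitions. *)
Definition seq_abs_cont a b x := forall e, 0 < e -> exists2 d, 0 < d &
  forall s, itv_family a b s -> family_length s < d -> family_variation x s <= e.

Lemma abs_cont_on_seq a b x : abs_cont_on a b x -> seq_abs_cont a b x.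
Proof.
move=> acx e /acx[d d0 H]; exists d => // s /andP[/all_nthP s1 s2].
rewrite /family_length /family_variation !(big_nth (0, 0)) !big_mkord => sd.
apply/ltW/(H (size s) (fun i => (nth (0, 0) s i).1)
  (fun i => (nth (0, 0) s i).2)) => //.
- by move=> i; have /and3P[] := s1 (0, 0) i (ltn_ord i).
- move/(pairwiseP (0, 0)) : s2 => s2 i j.
  rewrite neq_lt => /orP[]ij; have := s2 _ _ _ _ ij; rewrite !inE !ltn_ord;
    by move=> /(_ isT isT) /orP[]; auto.
Qed.

(** [zip] truncates the longer list, so the pairs are the consecutive intervals of the partition
    [u :: l]. *)
Definition steps u (l : seq R) := zip (u :: l) l.

Lemma steps_family u l : path <%R u l -> itv_family u (last u l) (steps u l).
Proof.
rewrite /steps; elim: l u => // c l ih u /= /andP[uc cl].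
have cL : c <= last c l.
  by elim: l c cl {ih uc} => //= h l ih c /andP[/ltW ch /ih]; exact: le_trans.
have /andP[h1 h2] := ih _ cl; apply/andP; split => /=.
  rewrite lexx (ltW uc) cL/=; apply: sub_all h1 => p /and3P[cp -> ->].
  by rewrite (le_trans (ltW uc) cp).
rewrite h2 andbT; apply: sub_all h1 => p /and3P[cp _ _].
by rewrite /nonoverlapping /= cp.
Qed.

Lemma steps_length u l : family_length (steps u l) = last u l - u.
Proof.
rewrite /family_length /steps; elim: l u => [|c l ih] u.
  by rewrite /= big_nil subrr.
by rewrite [zip _ _]/= big_cons ih /=; ring.
Qed.

Lemma steps_variation u v x l : itv_partition u v l ->
  family_variation x (steps u l) = variation u v x l.
Proof.
move=> ul; rewrite variation_zip// /family_variation /steps.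
elim: l u {ul} => [|c l ih] u; first by rewrite /= !big_nil.
by rewrite [zip _ _]/= [X in _ = \sum_(x <- X) _]/= !big_cons ih.
Qed.

Lemma family_length_cat s t :
  family_length (s ++ t) = family_length s + family_length t.
Proof. by rewrite /family_length big_cat. Qed.

Lemma family_variation_cat x s t :
  family_variation x (s ++ t) = family_variation x s + family_variation x t.
Proof. by rewrite /family_variation big_cat. Qed.

(** The pieces lie inside [p], so they inherit from it the bounds and the separation from [s] and
    [t]. They are inserted between [s] and [t] because the induction below keeps the intervals still
    to be refined in front. *)
Lemma itv_family_refine a b p l s t : itv_partition p.1 p.2 l ->
  itv_family a b (p :: s ++ t) -> itv_family a b (s ++ (steps p.1 l ++ t)).
Proof.
move=> [/steps_family + /eqP lp]; rewrite lp => /andP[/allP l1 l2].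
rewrite /itv_family /= => /andP[/andP[/and3P[ap pp pb]]].
rewrite !all_cat !pairwise_cat !allrel_catr.
move=> /andP[s1 t1] /andP[/andP[ps pt] /and3P[st s2 t2]].
rewrite s1 t1 s2 t2 st l2 /= !andbT; apply/and3P; split.
- apply/allP => q /l1 /and3P[pq qq qp].
  by rewrite (le_trans ap pq) qq (le_trans qp pb).
- apply/allrelP => r q rs /l1 /and3P[pq qq qp].
  have /(_ r rs)/orP[] := allP ps; rewrite /nonoverlapping => h.
    by rewrite (le_trans qp h) orbT.
  by rewrite (le_trans h pq).
- apply/allrelP => q r /l1 /and3P[pq qq qp] rt.
  have /(_ r rt)/orP[] := allP pt; rewrite /nonoverlapping => h.
    by rewrite (le_trans qp h).
  by rewrite (le_trans h pq) orbT.
Qed.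

Notation TV := total_variation.

(* The intervals of [s] are refined one at a time into partitions, which are
   moved into [t]; this avoids choosing near-optimal partitions at once. *)
Lemma sum_total_variation_le a b d e x :
  (forall s, itv_family a b s -> family_length s < d ->
     family_variation x s <= e) ->
  forall s t, itv_family a b (s ++ t) -> family_length (s ++ t) < d ->
  (\sum_(p <- s) TV p.1 p.2 x + (family_variation x t)%:E <= e%:E)%E.
Proof.
move=> H; elim=> [|p s ih] t st std.
  by rewrite big_nil add0e lee_fin; exact: H.
have refine l : itv_partition p.1 p.2 l ->
   (\sum_(p <- s) TV p.1 p.2 x +
     (variation p.1 p.2 x l + family_variation x t)%:E <= e%:E)%E.
  move=> pl; rewrite -(steps_variation _ pl) -family_variation_cat.
  apply: ih; first exact: itv_family_refine.
  move: std; rewrite /= {1}/family_length big_cons -/(family_length _).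
  rewrite !family_length_cat steps_length; case: pl => _ /eqP ->.
  by rewrite addrCA.
have pp : p.1 <= p.2 by move: st => /andP[/= /andP[/and3P[_ ->]]].
(* Finiteness allows the sum to be carried to the other side, which leaves a bound on every
   variation over [p] and hence on their supremum. It follows from [refine] applied to any one
   partition of [p], the empty one if [p] is degenerate. *)
have sfin : (\sum_(p <- s) TV p.1 p.2 x)%E \is a fin_num.
  rewrite ge0_fin_numE; last first.
    rewrite big_seq; apply: sume_ge0 => q qs; apply: total_variation_ge0.
    move: st => /andP[/= /andP[_ /allP /(_ q)]].
    by rewrite mem_cat qs => /(_ isT) /and3P[].
  have [l pl] : exists l, itv_partition p.1 p.2 l.
    move: pp; rewrite le_eqVlt => /predU1P[<-|pp].
      by exists [::]; split => //=.
    by exists [:: p.2]; exact: itv_partition1.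
  have := refine l pl; case: (\sum_(_ <- _) _)%E => [r _| |//] //=.
  by rewrite ltry.
rewrite big_cons -addeA -leeBrDr; last by rewrite fin_numD sfin.
apply: ge_ereal_sup => _ [_ [l pl <-] <-].
rewrite leeBrDr ?fin_numD ?sfin//.
by rewrite addeCA -EFinD; exact: refine.
Qed.

End IntervalFamilies.

(** * Uniform continuity, finite total variation and the Jordan decomposition *)

Section SeqAbsCont.
Variable R : realType.
Implicit Types (a b u v d e : R) (x : R -> R) (p q : R * R) (s t : seq (R * R)).
Notation TV := total_variation.

Lemma seq_abs_cont_small a b x : seq_abs_cont a b x ->
  forall e, 0 < e -> exists2 d, 0 < d & forall u v, a <= u -> u <= v -> v <= b ->
    v - u < d -> (TV u v x <= e%:E)%E.
Proof.
move=> acx e /acx[d d0 H]; exists d => // u v au uv vb uvd.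
have := sum_total_variation_le H (s := [:: (u, v)]) (t := [::]).
rewrite /family_length /family_variation cats0 !big_cons !big_nil/= addr0.
rewrite !adde0; apply => //.
by rewrite /itv_family /= au uv vb.
Qed.

Lemma seq_abs_cont_uniform a b x : seq_abs_cont a b x ->
  forall e, 0 < e -> exists2 d, 0 < d & forall u v, a <= u <= b -> a <= v <= b ->
    `|u - v| < d -> `|x u - x v| <= e.
Proof.
move=> /seq_abs_cont_small acx e /acx[d d0 H].
exists d => // u v; wlog vu : u v / v <= u.
  move=> h; have [/h//|/ltW/h {}h ua va] := leP v u.
  by rewrite distrC (distrC (x u)); exact: h.
move=> /andP[au ub] /andP[av vb]; rewrite ger0_norm ?subr_ge0// => uvd.
rewrite -lee_fin (le_trans (total_variation_ge _ vu))//.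
exact: H.
Qed.

Lemma seq_abs_cont_within_continuous a b x :
  seq_abs_cont a b x -> {within `[a, b], continuous x}.
Proof.
move=> /seq_abs_cont_uniform acx; apply/subspace_continuousP => t.
rewrite /= in_itv/= => tab; apply/cvgrPdist_le => /= e e0.
have [d d0 H] := acx _ e0.
rewrite near_withinE; apply/nbhs_ballP; exists d => //= s ts.
by rewrite /= in_itv/= => sab; exact: H.
Qed.

(** Cut [[a, b]] into [N.+1] equal pieces shorter than the [d] that belongs to the tolerance 1: each
    piece contributes at most 1, and the total variation is additive. *)
Lemma seq_abs_cont_total_variation a b x : a <= b -> seq_abs_cont a b x ->
  TV a b x \is a fin_num.
Proof.
move=> ab /seq_abs_cont_small/(_ 1 ltr01)[d d0 H].
pose N := Num.bound ((b - a) / d).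
pose h := (b - a) / N.+1%:R.
have h0 : 0 <= h by rewrite divr_ge0// subr_ge0.
have Nh : h * N.+1%:R = b - a by rewrite /h divfK// pnatr_eq0.
have hd : h < d.
  rewrite /h ltr_pdivrMr ?ltr0n// mulrC -ltr_pdivrMr//.
  rewrite (lt_le_trans (archi_boundP _))//; last by rewrite ler_nat.
  by rewrite divr_ge0 ?subr_ge0// ltW.
have step k : (k <= N.+1)%N -> (TV a (a + h * k%:R)%R x <= k%:R%:E)%E.
  elim: k => [|k ih] kN; first by rewrite mulr0 addr0 total_variationxx.
  have kle : a + h * k%:R <= a + h * k.+1%:R.
    by rewrite lerD2l ler_wpM2l// ler_nat.
  have ak : a <= a + h * k%:R by rewrite lerDl mulr_ge0.
  rewrite (total_variationD _ ak kle) -natr1 EFinD leeD//.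
    by apply: ih; exact: ltnW.
  rewrite natr1; apply: H => //.
    by rewrite -lerBrDl -Nh ler_wpM2l// ler_nat.
  rewrite (_ : _ - _ = h)//.
  by rewrite -natr1; ring.
rewrite ge0_fin_numE ?total_variation_ge0//.
have := step _ (leqnn _); rewrite Nh addrC subrK => /le_lt_trans; apply.
by rewrite ltry.
Qed.

Lemma seq_abs_contB a b x y :
  seq_abs_cont a b x -> seq_abs_cont a b y -> seq_abs_cont a b (x \- y).
Proof.
move=> acx acy e e0; have e20 : 0 < e / 2 by rewrite divr_gt0.
have [d1 d10 H1] := acx _ e20; have [d2 d20 H2] := acy _ e20.
exists (Num.min d1 d2) => [|s sab]; first by rewrite lt_min d10.
rewrite lt_min => /andP[/(H1 _ sab) h1 /(H2 _ sab) h2].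
rewrite [leRHS]splitr (le_trans _ (lerD h1 h2))//.
rewrite /family_variation -big_split/=; apply: ler_sum => p _.
have -> : x p.2 - y p.2 - (x p.1 - y p.1) = (x p.2 - x p.1) - (y p.2 - y p.1).
  by ring.
exact: ler_normB.
Qed.

Lemma eq_seq_abs_cont a b x y : {in `[a, b], x =1 y} ->
  seq_abs_cont a b x -> seq_abs_cont a b y.
Proof.
move=> xy acx e /acx[d d0 H]; exists d => // s sab sd.
rewrite (_ : family_variation _ _ = family_variation x s); first exact: H.
move: sab => /andP[/allP sab _]; apply: eq_big_seq => p /sab /and3P[ap pp pb].
by rewrite !xy// in_itv/= ?(le_trans ap pp) ?ap ?pb ?(le_trans pp pb).
Qed.

Section Jordan.
Variables (a b : R) (x : R -> R).
Hypotheses (ab : a <= b) (acx : seq_abs_cont a b x).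
Let V := fine \o TV a ^~ x.

Let TVfin u v : a <= u -> u <= v -> v <= b -> TV u v x \is a fin_num.
Proof.
move=> au uv vb; have := seq_abs_cont_total_variation ab acx.
rewrite (total_variationD _ (le_trans au uv) vb) (total_variationD _ au uv).
by rewrite !fin_numD => /andP[/andP[]].
Qed.

Let VE u v : a <= u -> u <= v -> v <= b -> (V v - V u)%:E = TV u v x.
Proof.
move=> au uv vb; have ub := le_trans uv vb.
rewrite /V/= (total_variationD _ au uv) fineD ?TVfin//.
by rewrite addrAC subrr add0r fineK ?TVfin.
Qed.

(** [V t] is the total variation of [x] on [[a, t]]. Its increments over a family are total
    variations of [x], so [sum_total_variation_le] gives its absolute continuity with the same [d];
    [V \- x] is nondecreasing since an increment of [x] is at most its variation. *)
Lemma seq_abs_cont_jordan : exists V : R -> R,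
  [/\ {in `[a, b] &, nondecreasing V}, seq_abs_cont a b V,
      {in `[a, b] &, nondecreasing (V \- x)} & seq_abs_cont a b (V \- x)].
Proof.
have acV : seq_abs_cont a b V.
  move=> e /acx[d d0 H]; exists d => // s sab sd.
  have := sum_total_variation_le H (s := s) (t := [::]).
  rewrite !cats0 => /(_ sab sd); rewrite /family_variation big_nil adde0.
  rewrite -lee_fin; apply: le_trans; rewrite -sumEFin big_seq [leRHS]big_seq.
  apply: lee_sum => p ps; have /andP[/allP/(_ p ps)/and3P[ap pp pb] _] := sab.
  rewrite -VE// lee_fin ger0_norm// -lee_fin VE// total_variation_ge0//.
exists V; split => //; last exact: seq_abs_contB.
- move=> u v; rewrite !in_itv/= => /andP[au ub] /andP[av vb] uv.
  by rewrite -subr_ge0 -lee_fin VE// total_variation_ge0.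
- move=> u v; rewrite !in_itv/= => /andP[au ub] /andP[av vb] uv.
  rewrite -subr_ge0 (_ : _ - _ = (V v - V u) - (x v - x u)); last by ring.
  rewrite subr_ge0 -lee_fin VE// (le_trans _ (total_variation_ge _ uv))//.
  by rewrite lee_fin ler_norm.
Qed.

End Jordan.

End SeqAbsCont.

(** * Lebesgue-Stieltjes measures dominated by the Lebesgue measure, and their densities *)

Section StieltjesDensity.
Variable R : realType.
Implicit Types (a b u v d e : R) (p q : R * R) (s t : seq (R * R)).
Local Notation mu := (@lebesgue_measure R).
Local Notation LS := (@lebesgue_stieltjes_measure R).

Lemma lebesgue_stieltjes_itv_oc (F : cumulative R R) u v : u <= v ->
  LS F `]u, v]%classic = (F v - F u)%:E.
Proof.
move=> uv; rewrite /lebesgue_stieltjes_measure /= /measure_extension.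
rewrite measurable_mu_extE/=; last exact: is_ocitv.
exact: wlength_itv_bnd.
Qed.

Lemma nonoverlapping_ocitv p q : p.1 < p.2 -> q.1 < q.2 ->
  `]p.1, p.2]%classic `&` `]q.1, q.2]%classic = set0 -> nonoverlapping p q.
Proof.
move=> pp qq pq0; apply/negPn/negP; rewrite negb_or -!ltNge => /andP[qp pq].
suff : (set0 : set R) (Num.min p.2 q.2) by [].
by rewrite -pq0; split; rewrite /= in_itv/= lt_min ge_min lexx ?orbT ?andbT;
  apply/andP.
Qed.

(** A finite union of half-open intervals belongs to the ring they generate, hence is a finite
    disjoint union of such intervals. One [s] serves all [F], so that Lebesgue and Stieltjes
    measures can be compared on the same family. *)
Lemma ocitv_bigsetU_family (A : nat -> set R) n : (forall k, ocitv (A k)) ->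
  exists s, [/\ all (fun p => p.1 < p.2) s, pairwise (@nonoverlapping R) s,
    \big[setU/set0]_(k < n) A k = \bigcup_(p in [set` s]) `]p.1, p.2]%classic &
    forall F : cumulative R R,
      LS F (\big[setU/set0]_(k < n) A k) = (\sum_(p <- s) (F p.2 - F p.1))%:E].
Proof.
move=> mA.
have : (measurable : set (set (SetRing.type (ocitv_type R))))
    (\big[setU/set0]_(k < n) A k).
  apply: bigsetU_measurable => k _.
  by apply: SetRing.measurable_subring; exact: mA.
move=> /SetRing.ring_finite_set[B [Bfin Bne Btriv Bm ->]].
(* End points of a block of the decomposition; the blocks are nonempty, so the default [(0, 0)] is
   never taken and the end points are strictly ordered. *)
pose pr (X : set R) : R * R :=
  xget (0, 0) [set p | p.1 < p.2 /\ X = `]p.1, p.2]%classic].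
have prP X : B X -> (pr X).1 < (pr X).2 /\ X = `](pr X).1, (pr X).2]%classic.
  move=> BX; have /ocitvP[X0|[p pp Xp]] : ocitv X by apply: Bm; rewrite inE.
    by have [r] := Bne _ BX; rewrite X0.
  by rewrite /pr; case: xgetP => [q _ //|/(_ p)[]].
pose r : seq (set R) := enum_fset (fset_set B).
have rB X : (X \in r) = (X \in B) by rewrite in_fset_set.
exists (map pr r); split.
- by apply/allP => _ /mapP[X + ->]; rewrite rB inE => /prP[].
- rewrite pairwise_map; have := fset_uniq (fset_set B); rewrite uniq_pairwise.
  apply: (@sub_in_pairwise _ (mem r)); last exact/allP.
  move=> X Y Xr Yr XY.
  have BX : B X by apply/set_mem; rewrite -rB.
  have BY : B Y by apply/set_mem; rewrite -rB.
  have [pX XE] := prP _ BX; have [pY YE] := prP _ BY.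
  apply: nonoverlapping_ocitv => //; rewrite -XE -YE.
  apply/eqP/negPn/negP => /set0P XY0.
  by move/eqP : XY; apply; exact: Btriv.
- apply/seteqP; split=> [z [X BX Xz]|z [_ /= /mapP[X + ->]]].
    have [_ XE] := prP _ BX; exists (pr X); last by rewrite -XE.
    by apply/mapP; exists X => //; rewrite rB inE.
  by rewrite rB inE => BX Xr; exists X => //; have [_ ->] := prP _ BX.
- move=> F; rewrite measure_fin_bigcup//=; last first.
    by move=> X BX; apply: sub_sigma_algebra; apply: Bm; rewrite inE.
  rewrite fsbig_finite//= big_map -sumEFin; apply: eq_big_seq => X.
  rewrite in_fset_set// inE => BX; have [pX {1}->] := prP _ BX.
  by rewrite lebesgue_stieltjes_itv_oc// ltW.
Qed.

Section Domination.
Variables (a b : R) (F : cumulative R R).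
Hypotheses (ab : a < b) (acF : seq_abs_cont a b F).

Let mD : measurable (`]a, b]%classic : set (measurableTypeR R)).
Proof. exact: measurable_itv. Qed.

Let Dfin : (LS F `]a, b]%classic < +oo)%E.
Proof. by rewrite lebesgue_stieltjes_itv_oc ?ltry// ltW. Qed.

(* A cover of a Lebesgue-null set by intervals of small total length is made
   disjoint in the ring of finite unions, where absolute continuity applies. *)
Lemma stieltjes_dominated : mfrestr mD Dfin `<< mu.
Proof.
apply/null_content_dominatesP => A mA A0.
apply/eqP; rewrite eq_le measure_ge0 andbT.
rewrite /mfrestr /mrestr.
apply/lee_addgt0Pr => e e0; rewrite add0e.
have [d d0 H] := acF e0.
have /ereal_inf_lt[z [/= M' [mM' AM'] <-] Md] : (mu A < d%:E)%E.
  by rewrite A0 lte_fin.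
pose M k : set R := M' k `&` `]a, b]%classic.
have ocM k : ocitv (M k) by apply: ocitvI; [exact: mM'|exact: is_ocitv].
have mM k : measurable (M k : set (measurableTypeR R)).
  by apply: sub_sigma_algebra; exact: ocM.
have bnd n : (LS F (\big[setU/set0]_(k < n) M k) <= e%:E)%E.
  have [s [s1 s2 sE sF]] := ocitv_bigsetU_family n ocM.
  rewrite sF lee_fin; have sab : itv_family a b s.
    rewrite /itv_family s2 andbT; apply/allP => p ps.
    have pp := allP s1 _ ps; rewrite (ltW pp)/=.
    have pab : `]p.1, p.2]%classic `<=` `]a, b]%classic.
      move=> r rp; suff : (\big[setU/set0]_(k < n) M k) r.
        by rewrite -bigcup_mkord => -[k _ []].
      by rewrite sE; exists p.
    have : `]a, b]%classic p.2 by apply: pab; rewrite /= in_itv/= pp lexx.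
    rewrite /= in_itv/= => /andP[_ ->]; rewrite andbT leNgt.
    (* If [p.1 < a], the point [m] lies in []p.1, p.2]] but not to the right of [a], against
       [pab]. *)
    apply/negP => pa; pose m := Num.min a p.2.
    have : `]a, b]%classic m.
      by apply: pab; rewrite /= in_itv/= /m lt_min pa pp ge_min lexx orbT.
    by rewrite /= in_itv/= /m lt_min ltxx.
  have /(H s sab) : family_length s < d.
    (* The Stieltjes measure of [idfun] is the Lebesgue measure, so the length of [s] is the measure
       of the finite union, which the total length of the cover bounds. *)
    rewrite -lte_fin; have <- := sF idfun.
    apply: le_lt_trans Md.
    apply: (@le_trans _ _ (\sum_(k < n) mu (M k))%E).
      exact: Boole_inequality.
    apply: (@le_trans _ _ (\sum_(k < n) wlength idfun (M' k))%E).
      apply: lee_sum => k _.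
      rewrite -[leRHS]measurable_mu_extE//.
      apply: le_mu_ext.
      exact: subIsetl.
    rewrite -(big_mkord xpredT (fun k => wlength idfun (M' k))).
    by apply: nneseries_lim_ge => k _ _; exact: measure_ge0.
  apply: le_trans; apply: ler_sum => p _; exact: ler_norm.
(* The bound [bnd] is uniform in [n] and the finite unions increase, so continuity from below
   extends it to the whole cover. *)
apply: (@le_trans _ _ (LS F (\bigcup_n \big[setU/set0]_(k < n) M k))).
  apply: le_measure; rewrite ?inE.
  - exact: measurableI.
  - apply: bigcup_measurable => n _; apply: bigsetU_measurable => k _.
    exact: mM.
  - move=> r [/AM'[k _ Mkr] rab]; exists k.+1 => //.
    by rewrite -bigcup_mkord; exists k => //=.
have cv : LS F \o (fun n => \big[setU/set0]_(k < n) M k) @ \oo -->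
    LS F (\bigcup_n \big[setU/set0]_(k < n) M k).
  apply: nondecreasing_cvg_mu.
  - by move=> n; apply: bigsetU_measurable => k _; exact: mM.
  - apply: bigcup_measurable => n _; apply: bigsetU_measurable => k _.
    exact: mM.
  - by move=> m n mn; apply/subsetPset; exact: subset_bigsetU.
apply: (cvge_le _ cv).
by apply: nearW => n; exact: bnd.
Qed.

(** The Radon-Nikodym density, integrated over []a, r]], returns the Stieltjes mass [F r - F a];
    adding the point [a] does not change a Lebesgue integral. *)
Lemma cumulative_density : exists2 f : R -> R, mu.-integrable setT (EFin \o f) &
  forall r, a <= r <= b -> F r = F a + \int[mu]_(z in `[a, r]) f z.
Proof.
have := radon_nikodym_sigma_finite stieltjes_dominated.
move=> [f [f0 ffin fi fE]]; have fineE : EFin \o (fine \o f) = f.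
  by apply/funext => r /=; rewrite fineK.
exists (fine \o f) => [|t /andP[at_ tb]]; first by rewrite fineE.
have : LS F `]a, t]%classic = (\int[mu]_(x in `]a, t]) f x)%E.
  rewrite -fE; last exact: measurable_itv.
  suff E : `]a, t] `&` `]a, b] = `]a, t]%classic :> set R.
    by rewrite -[in LHS]E.
  rewrite setIidl// => r; rewrite /= !in_itv/=.
  by move=> /andP[-> /le_trans]; exact.
rewrite lebesgue_stieltjes_itv_oc//.
rewrite -Rintegral_itv_obnd_cbnd; last first.
  by rewrite fineE; apply: integrableS fi.
rewrite /Rintegral => /(congr1 fine)/= FE.
rewrite -[LHS](subrK (F a)) addrC FE; congr (_ + fine _).
by apply: eq_integral => r _ /=; rewrite fineK.
Qed.

End Domination.
End StieltjesDensity.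

(** * From densities to almost everywhere derivatives *)

Section AbsContDensity.
Variable R : realType.
Implicit Types (a b t : R) (x f : R -> R).
Local Notation mu := (@lebesgue_measure R).

(** Projection onto [[a, b]]: composing with it extends a function by constants beyond the end
    points. *)
Definition clamp a b t := Num.max a (Num.min t b).

Lemma clamp_itv a b t : a <= b -> a <= clamp a b t <= b.
Proof. by move=> ab; rewrite /clamp le_max lexx ge_max ab ge_min lexx orbT. Qed.

Lemma clamp_id a b t : a <= t <= b -> clamp a b t = t.
Proof.
by move=> /andP[at_ tb]; rewrite /clamp (min_idPl tb); exact/max_idPr.
Qed.

Lemma clamp_nondecreasing a b : {homo clamp a b : s t / s <= t}.
Proof.
move=> s t st; rewrite /clamp ge_max !le_max lexx/= le_min !ge_min.
by rewrite st lexx !orbT.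
Qed.

Lemma clamp_contracting a b s t : `|clamp a b s - clamp a b t| <= `|s - t|.
Proof.
wlog st : s t / s <= t => [h|].
  by have [/h//|/ltW/h] := leP s t; rewrite distrC [leRHS]distrC.
rewrite distrC [leRHS]distrC !ger0_norm ?subr_ge0// ?clamp_nondecreasing//.
rewrite /clamp; case: (leP s b) => sb; case: (leP t b) => tb;
  rewrite /Num.max; repeat case: ifPn; rewrite -?leNgt; lra.
Qed.

(** A cumulative function lives on the whole line. Composing [F] with [clamp], which is monotone and
    1-Lipschitz, preserves monotonicity and continuity and leaves the values on [[a, b]]
    unchanged. *)
Lemma nondecreasing_density a b F : a < b ->
  {in `[a, b] &, nondecreasing F} -> seq_abs_cont a b F ->
  exists2 f : R -> R, mu.-integrable setT (EFin \o f) &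
    forall t, a <= t <= b -> F t = F a + \int[mu]_(s in `[a, t]) f s.
Proof.
move=> ab ndF acF; pose G t := F (clamp a b t).
have GE t : a <= t <= b -> G t = F t by move=> tab; rewrite /G clamp_id.
have Gnd : nondecreasing G.
  move=> s t st; apply: ndF; rewrite ?in_itv/= ?clamp_itv ?(ltW ab)//.
  exact: clamp_nondecreasing.
have Grc : right_continuous G.
  apply: right_continuousW => t; apply/cvgrPdist_le => /= e e0.
  have [d d0 H] := seq_abs_cont_uniform acF e0; near=> s.
  apply: H; rewrite ?clamp_itv ?(ltW ab)//.
  apply: le_lt_trans (clamp_contracting _ _ _ _) _.
  by near: s; exists d.
pose mG := isCumulative.Build R _ R G Gnd Grc.
pose C : cumulative R R := HB.pack G mG.
have acC : seq_abs_cont a b C.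
  by apply: eq_seq_abs_cont acF => t; rewrite in_itv/= => /GE <-.
have [f fi fE] := cumulative_density ab acC.
exists f => // t tab; have := fE t tab; rewrite /= !GE//.
by rewrite lexx ltW.
Unshelve. all: by end_near. Qed.

Lemma seq_abs_cont_density a b x : a < b -> seq_abs_cont a b x ->
  exists2 f : R -> R, mu.-integrable setT (EFin \o f) &
    forall t, a <= t <= b -> x t = x a + \int[mu]_(s in `[a, t]) f s.
Proof.
move=> ab acx; have [V [ndV acV ndW acW]] := seq_abs_cont_jordan (ltW ab) acx.
have [f fi fE] := nondecreasing_density ab ndV acV.
have [g gi gE] := nondecreasing_density ab ndW acW.
exists (f \- g) => [|t tab].
  rewrite (_ : EFin \o _ = ((EFin \o f) \- (EFin \o g))%E)//.
  exact: integrableB.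
rewrite RintegralB//; [|by apply: integrableS fi|by apply: integrableS gi].
have := fE t tab; have := gE t tab; rewrite /=; lra.
Qed.

(** Lebesgue differentiation applies to the primitive of [f]. Only at an interior point does [x]
    agree with that primitive on a neighbourhood, so the two end points are discarded as null
    sets. *)
Lemma density_derive1 a b x f : mu.-integrable setT (EFin \o f) ->
  (forall t, a <= t <= b -> x t = x a + \int[mu]_(s in `[a, t]) f s) ->
  {ae mu, forall t, t \in `[a, b] -> derive1 x t = f t}.
Proof.
move=> fi xE.
have fiy y : mu.-integrable [set` Interval (BLeft a) (BRight y)] (EFin \o f).
  by apply: integrableS fi.
have := FTC1 fiy (open_integrable_locally openT fi).
have neq c : {ae mu, forall t : R, t != c}.
  exists [set c]; split; [exact: measurable_set1|exact: lebesgue_measure_set1|].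
  by move=> t /= /negP; rewrite negbK => /eqP.
move: (neq a) (neq b).
apply: (@filterS3 _ _ (ae_filter_ringOfSetsType mu)) => t /= ta tb.
move=> /[!in_itv]/= + /andP[at_ tb'].
have at' : a < t by rewrite lt_neqAle eq_sym ta.
set F := (fun y => _) => -[|dF <-]; first by rewrite lte_fin.
have tb_ : t < b by rewrite lt_neqAle tb.
rewrite !derive1E.
transitivity ('D_1 (cst (x a) \+ F) t).
  apply: near_eq_derive.
  near=> s; rewrite /= xE//; apply/andP; split; apply/ltW.
    by near: s; exact: lt_nbhsr.
  by near: s; exact: lt_nbhsl.
by rewrite deriveD// derive_cst add0r.
Unshelve. all: by end_near. Qed.

Lemma abs_cont_FTC a b x : a < b -> abs_cont_on a b x ->
  exists2 f : R -> R, mu.-integrable setT (EFin \o f) &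
    (forall t, a <= t <= b -> x t = x a + \int[mu]_(s in `[a, t]) f s) /\
    {ae mu, forall t, t \in `[a, b] -> derive1 x t = f t}.
Proof.
move=> ab /abs_cont_on_seq /(seq_abs_cont_density ab)[f fi fE].
by exists f => //; split => //; exact: density_derive1.
Qed.

End AbsContDensity.

(** * The Abel kernel and Fubini on a triangle *)

Section AbelKernel.
Variables (R : realType) (q : R).
Hypothesis q0 : 0 < q.
Implicit Types (a b c d s t : R).
Local Notation mu := (@lebesgue_measure R).

(** One kernel for three uses: [q = beta] for fractional integrals, [q = 1 - alpha] for the Caputo
    derivative, and [q = 1] for ordinary integrals over a triangle. *)
Definition abel_kernel t s := (t - s) `^ (q - 1).

Lemma abel_kernel_ge0 t s : 0 <= abel_kernel t s.
Proof. exact: powR_ge0. Qed.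

Lemma measurable_abel_kernel s (D : set R) :
  measurable_fun D (abel_kernel ^~ s).
Proof.
apply: measurable_funTS.
apply: (measurableT_comp (measurable_powR (q - 1))).
exact: measurable_funB.
Qed.

Lemma measurable_abel_kernelr t (D : set R) :
  measurable_fun D (abel_kernel t).
Proof.
apply: measurable_funTS.
apply: (measurableT_comp (measurable_powR (q - 1))).
exact: measurable_funB.
Qed.

Lemma is_derive_abel_kernel s t : s < t ->
  is_derive t 1 (fun t => (t - s) `^ q / q) (abel_kernel t s).
Proof.
move=> st; have ts0 : 0 < t - s by rewrite subr_gt0.
have H1 : is_derive (t - s) 1 (@powR R ^~ q) (q * (t - s) `^ (q - 1)).
  exact: is_derive1_powR.
have H2 : is_derive t 1 (fun t => t - s) 1.
  by apply: is_derive_eq; rewrite subr0.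
have H := @is_derive1_comp R (@powR R ^~ q) (fun t => t - s) t _ _ H1 H2.
have -> : (fun t => (t - s) `^ q / q) =
    (q^-1 *: ((@powR R ^~ q) \o (fun t => t - s))).
  by apply/funext => r; rewrite /= mulrC.
apply: is_derive_eq.
by rewrite mulr1 /GRing.scale/= mulrA mulVf ?gt_eqF// mul1r.
Qed.

Lemma abel_kernel_continuous s t : s < t -> {for t, continuous (abel_kernel ^~ s)}.
Proof.
move=> st; have ts0 : 0 < t - s by rewrite subr_gt0.
apply: (@continuous_comp _ _ _ (fun t => t - s) (@powR R ^~ (q - 1))).
  by apply: continuousB; [exact: cvg_id|exact: cvg_cst].
apply/differentiable_continuous/derivable1_diffP.
by apply: ex_derive; exact: is_derive1_powR.
Qed.

Lemma abel_kernel_integral_lt s c d : s < c -> c <= d ->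
  (\int[mu]_(t in `[c, d]) (abel_kernel t s)%:E =
   (((d - s) `^ q - (c - s) `^ q) / q)%:E)%E.
Proof.
move=> sc; rewrite le_eqVlt => /predU1P[<-|cd].
  by rewrite set_itv1 integral_set1 subrr mul0r.
pose F t := (t - s) `^ q / q.
have dF t : s < t -> is_derive t 1 F (abel_kernel t s).
  exact: is_derive_abel_kernel.
have cF t : s < t -> {for t, continuous F}.
  move=> st; apply/differentiable_continuous/derivable1_diffP.
  by apply: ex_derive; exact: dF.
rewrite (@continuous_FTC2 _ _ F)//.
- by rewrite -EFinB /F -mulrBl.
- apply: continuous_in_subspaceT => t; rewrite inE/= in_itv/= => /andP[ct _].
  by apply: abel_kernel_continuous; exact: lt_le_trans ct.
- split.
  + move=> t; rewrite in_itv/= => /andP[ct _].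
    by apply: ex_derive; apply: dF; exact: lt_trans ct.
  + by apply: cvg_at_right_filter; exact: cF.
  + by apply: cvg_at_left_filter; apply: cF; exact: lt_trans cd.
- move=> t; rewrite in_itv/= => /andP[ct _]; rewrite derive1E.
  by have [_ ->] := dF t (lt_trans sc ct).
Qed.

(** For [c = s] and [q < 1] the kernel is singular at the end point, so the integral is a monotone
    limit of integrals over [[c n, d]] with [c n] decreasing to [s]. The correction [(c n - s) ^ q]
    tends to 0 because [q] is positive. *)
Lemma abel_kernel_integral s c d : s <= c -> c <= d ->
  (\int[mu]_(t in `[c, d]) (abel_kernel t s)%:E =
   (((d - s) `^ q - (c - s) `^ q) / q)%:E)%E.
Proof.
rewrite le_eqVlt => /predU1P[<-{c}|]; last exact: abel_kernel_integral_lt.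
rewrite le_eqVlt => /predU1P[<-|sd].
  by rewrite set_itv1 integral_set1 subrr mul0r.
rewrite subrr powR0 ?gt_eqF// subr0.
pose c n := s + (d - s) / n.+1%:R.
have ds0 : 0 < d - s by rewrite subr_gt0.
have sc n : s < c n by rewrite ltrDl divr_gt0.
have cd n : c n <= d.
  by rewrite -lerBrDl ler_pdivrMr// ler_peMr ?ler1n// ltW.
have UE : \bigcup_n `[c n, d]%classic = `]s, d]%classic.
  apply/seteqP; split=> [t [n _]|t]; rewrite /= !in_itv/= => /andP[st td].
    by rewrite td (lt_le_trans (sc n) st).
  exists (Num.bound ((d - s) / (t - s))) => //=; rewrite in_itv/= td andbT.
  have ts0 : 0 < t - s by rewrite subr_gt0.
  rewrite -lerBrDl ler_pdivrMr// mulrC -ler_pdivrMr//.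
  rewrite (le_trans (ltW (archi_boundP _)))// ?ler_nat//.
  by rewrite divr_ge0// ltW.
rewrite -integral_itv_obnd_cbnd; last first.
  by apply/measurable_EFinP; exact: measurable_abel_kernel.
rewrite -UE.
have H : (\int[mu]_(t in `[c n, d]) (abel_kernel t s)%:E)%E @[n --> \oo] -->
    (\int[mu]_(t in \bigcup_n `[c n, d]%classic) (abel_kernel t s)%:E)%E.
  apply: ge0_nondecreasing_set_cvg_integral.
  - apply/nondecreasing_seqP => n; apply/subsetPset => t /=.
    rewrite !in_itv/= => /andP[ct ->]; rewrite andbT (le_trans _ ct)//.
    by rewrite lerD2l ler_pM2l// lef_pV2 ?posrE ?ltr0n// ler_nat.
  - by move=> n; exact: measurable_itv.
  - by move=> n; apply/measurable_EFinP; exact: measurable_abel_kernel.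
  - by move=> n t _; rewrite lee_fin abel_kernel_ge0.
have hq : (@harmonic R n) `^ q @[n --> \oo] --> 0.
  have /cvg_at_rightP := powR_cvg0 q0.
  apply; split; last exact: cvg_harmonic.
  by move=> n; rewrite /harmonic/= invr_gt0.
have HE : (fun n => (\int[mu]_(t in `[c n, d]) (abel_kernel t s)%:E)%E) =
    EFin \o
      (fun n => ((d - s) `^ q - (d - s) `^ q * (@harmonic R n) `^ q) / q).
  apply/funext => n /=; rewrite abel_kernel_integral_lt// /c.
  by rewrite [s + _]addrC addrK powRM// ?ltW// invr_gt0.
rewrite HE in H.
apply: cvg_unique H _; first exact: ereal_hausdorff.
apply: cvg_EFin; first exact: nearW.
have : ((d - s) `^ q - (d - s) `^ q * (@harmonic R n) `^ q) / q
    @[n --> \oo] --> ((d - s) `^ q - (d - s) `^ q * 0) / q.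
  apply: cvgMr_tmp; apply: cvgB; first exact: cvg_cst.
  by apply: cvgMl_tmp.
by rewrite mulr0 subr0.
Qed.

End AbelKernel.

(** The norm of an inner integral is at most the inner integral of the norm, and the latter has a
    finite outer integral by Tonelli. *)
Lemma integrable_fubini_G d1 d2 (T1 : measurableType d1)
    (T2 : measurableType d2) (R : realType)
    (m1 : {sigma_finite_measure set T1 -> \bar R})
    (m2 : {sigma_finite_measure set T2 -> \bar R}) (f : T1 * T2 -> \bar R) :
  (m1 \x m2)%E.-integrable setT f -> m2.-integrable setT (fubini_G m1 f).
Proof.
move=> fi; have mf := measurable_int _ fi.
apply/integrableP; split; first exact: (measurable_fubini_G fi).
apply: le_lt_trans ((integrable21ltyP _ _ mf).1 fi).
apply: ge0_le_integral => //.
- apply: measurableT_comp => //; exact: (measurable_fubini_G fi).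
- apply: (@measurable_fun_fubini_tonelli_G _ _ _ _ _ m1 (abse \o f)) => //=.
  exact: measurableT_comp.
- move=> s _; apply: le_abse_integral => //.
  exact: measurableT_comp.
Qed.

Section RealIntegrable.
Context d (T : measurableType d) (R : realType).
Variables (m : {measure set T -> \bar R}) (D : set T).
Hypothesis mD : measurable D.
Implicit Types f g : T -> R.

Lemma integrable_EFinD f g : m.-integrable D (EFin \o f) ->
  m.-integrable D (EFin \o g) ->
  m.-integrable D (EFin \o (fun t => f t + g t)).
Proof. by move=> fi gi; have := integrableD mD fi gi. Qed.

Lemma integrable_EFinB f g : m.-integrable D (EFin \o f) ->
  m.-integrable D (EFin \o g) ->
  m.-integrable D (EFin \o (fun t => f t - g t)).
Proof. by move=> fi gi; have := integrableB mD fi gi. Qed.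

Lemma integrable_EFinZ c f : m.-integrable D (EFin \o f) ->
  m.-integrable D (EFin \o (fun t => c * f t)).
Proof. by move=> fi; have := integrableZl mD c fi. Qed.

Lemma integrable_EFin_norm f : m.-integrable D (EFin \o f) ->
  m.-integrable D (EFin \o (fun t => `|f t|)).
Proof. by move=> fi; have := integrable_abse fi. Qed.

End RealIntegrable.

(** * Exchanging the order of integration on a triangle *)

Section Volterra.
Variables (R : realType).
Local Notation mu := (@lebesgue_measure R).
Implicit Types (a b c d s t : R).

(** Inner integrals in Fubini's theorem are finite only almost everywhere; truncating them by [fine]
    alters them on a null set. *)
Lemma fine_integral_fine (F : R -> \bar R) : mu.-integrable setT F ->
  fine (\int[mu]_t F t)%E = \int[mu]_t fine (F t).
Proof.
move=> iF; rewrite /Rintegral; congr fine; apply: ae_eq_integral => //.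
- exact: measurable_int iF.
- apply/measurable_EFinP; apply: measurableT_comp => //.
  exact: measurable_int iF.
- apply: filterS (integrable_ae measurableT iF).
  by move=> t /= + _ => /(_ I) /fineK.
Qed.

Lemma Rintegral_Fubini (h : R * R -> R) :
  (mu \x mu)%E.-integrable setT (EFin \o h) ->
  \int[mu]_t \int[mu]_s h (t, s) = \int[mu]_s \int[mu]_t h (t, s).
Proof.
move=> ih; have := Fubini ih.
move=> /(congr1 fine).
rewrite (fine_integral_fine (integrable_fubini_F ih)).
by rewrite (fine_integral_fine (integrable_fubini_G ih)).
Qed.

Variables (q : R).
Hypothesis q0 : 0 < q.
Local Notation k := (abel_kernel q).

Lemma abel_kernel_mul_integrable s c d (G : R -> R) (M : R) :
  s <= c -> c <= d ->
  measurable_fun `[c, d] G -> (forall t, c <= t <= d -> `|G t| <= M) ->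
  mu.-integrable `[c, d] (EFin \o (fun t => k t s * G t)).
Proof.
move=> sc cd mG GM.
have ik : mu.-integrable `[c, d] (EFin \o k ^~ s).
  apply/integrableP; split.
    by apply/measurable_EFinP; exact: measurable_abel_kernel.
  under eq_integral do rewrite /= ger0_norm ?abel_kernel_ge0//.
  by rewrite abel_kernel_integral// ltry.
have iMk : mu.-integrable `[c, d] (fun t => M%:E * (k t s)%:E)%E.
  exact: integrableZl.
apply: le_integrable iMk => //.
- apply/measurable_EFinP; apply: measurable_funM => //.
  exact: measurable_abel_kernel.
- move=> t; rewrite /= in_itv/= => tcd; rewrite lee_fin !normrM mulrC.
  rewrite ler_wpM2r// (le_trans (GM _ tcd))//; exact: ler_norm.
Qed.

(** Both sides are iterated integrals over the plane of one function [h], extended by zero off the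
    triangle. As [f] is merely integrable and [G] bounded, integrability of [h] is obtained by
    integrating in [t] first. *)
Lemma volterra_fubini a b (f G : R -> R) (M : R) : a <= b ->
  mu.-integrable `[a, b] (EFin \o f) ->
  (forall t, a <= t <= b ->
     mu.-integrable `[a, t] (EFin \o (fun s => k t s * f s))) ->
  measurable_fun `[a, b] G -> (forall t, a <= t <= b -> `|G t| <= M) ->
  \int[mu]_(t in `[a, b]) (G t * \int[mu]_(s in `[a, t]) (k t s * f s)) =
  \int[mu]_(s in `[a, b]) (f s * \int[mu]_(t in `[s, b]) (k t s * G t)).
Proof.
move=> ab fi kfi mG GM.
have M0 : 0 <= M by rewrite (le_trans _ (GM a _))// lexx ab.
(* The restriction is needed since [powR] does not vanish at a negative base, while [h] has to be
   zero for [t < s]. *)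
pose kap : R -> R := (@powR R ^~ (q - 1)) \_ `[0, +oo[.
pose f0 := f \_ `[a, b]; pose G0 := G \_ `[a, b].
pose h (z : R * R) := G0 z.1 * (kap (z.1 - z.2) * f0 z.2).
have kapE t s : kap (t - s) = if s <= t then k t s else 0.
  by rewrite /kap patchE mem_setE in_itv/= andbT subr_ge0.
have f0E s : f0 s = if a <= s <= b then f s else 0.
  by rewrite /f0 patchE mem_setE in_itv.
have G0E t : G0 t = if a <= t <= b then G t else 0.
  by rewrite /G0 patchE mem_setE in_itv.
have mf0 : measurable_fun setT f0.
  apply/(measurable_restrictT _ _).1 => //.
  by have /integrableP[/measurable_EFinP] := fi.
have mnf0 : measurable_fun setT (fun s => `|f0 s|) by exact: measurableT_comp.
have mG0 : measurable_fun setT G0 by exact/(measurable_restrictT _ _).1.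
have mkap : measurable_fun setT kap.
  by apply/(measurable_restrictT _ _).1 => //; apply: measurable_funTS;
    exact: measurable_powR.
have mh : measurable_fun setT h.
  apply: measurable_funM; first exact: measurableT_comp.
  apply: measurable_funM; last exact: measurableT_comp.
  by apply: measurableT_comp => //; exact: measurable_funB.
have hL t : \int[mu]_s h (t, s) =
    ((fun t => G t * \int[mu]_(s in `[a, t]) (k t s * f s)) \_ `[a, b]) t.
  rewrite patchE mem_setE in_itv/=; case: ifPn => tab; last first.
    under eq_Rintegral do rewrite /h/= G0E (negbTE tab) mul0r.
    by rewrite Rintegral_cst// mul0r.
  rewrite -RintegralZl//; last exact: kfi.
  rewrite [RHS]Rintegral_mkcond; apply: eq_Rintegral => s _.
  rewrite /h/= patchE mem_setE in_itv/= G0E tab kapE f0E.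
  case/andP: tab => at_ tb; have [as_|] /= := leP a s; last by rewrite !mulr0.
  have [st|] /= := leP s t; last by rewrite mul0r mulr0.
  by rewrite (le_trans st tb).
have hR s : \int[mu]_t h (t, s) =
    ((fun s => f s * \int[mu]_(t in `[s, b]) (k t s * G t)) \_ `[a, b]) s.
  rewrite patchE mem_setE in_itv/=; case: ifPn => sab; last first.
    under eq_Rintegral do rewrite /h/= f0E (negbTE sab) !mulr0.
    by rewrite Rintegral_cst// mul0r.
  case/andP: sab => as_ sb.
  rewrite -RintegralZl//; last first.
    apply: (@abel_kernel_mul_integrable _ _ _ _ M) => //.
    - apply: measurable_funS mG => // t; rewrite /= !in_itv/=.
      by move=> /andP[st ->]; rewrite (le_trans as_ st).
    - by move=> t /andP[st tb]; rewrite GM// (le_trans as_ st).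
  rewrite [RHS]Rintegral_mkcond; apply: eq_Rintegral => t _.
  rewrite /h/= patchE mem_setE in_itv/= G0E kapE f0E as_ sb/=.
  have [st|] /= := leP s t; last by rewrite mul0r mulr0.
  rewrite (le_trans as_ st)/=; case: ifP => _; last by rewrite mul0r.
  by ring.
have ih : (mu \x mu)%E.-integrable setT (EFin \o h).
  (* [C] bounds, uniformly in [s], the factor [M] times the integral of the kernel over [[s, b]],
     namely [M * ((b - s) ^ q / q)]. *)
  apply/integrable21ltyP; first exact/measurable_EFinP.
  pose C := M * ((b - a) `^ q / q).
  have C0 : 0 <= C by rewrite mulr_ge0// divr_ge0 ?powR_ge0// ltW.
  have if0 : mu.-integrable setT (EFin \o f0).
    by rewrite /f0 -restrict_EFin; apply/integrable_restrict => //=; rewrite setTI.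
  apply: (@le_lt_trans _ _ (\int[mu]_s (C%:E * `|(f0 s)%:E|))%E); last first.
    rewrite ge0_integralZl//.
    - by rewrite lte_mul_pinfty// ?lee_fin//; move/integrableP : if0 => [].
    - exact/measurable_EFinP.
  apply: ge0_le_integral => //.
  - by move=> s _; exact: integral_ge0.
  - have mah : measurable_fun setT (fun z => (`|h z|)%:E).
      by apply/measurable_EFinP; exact: measurableT_comp.
    have h0 z : (0 <= (`|h z|)%:E)%E by rewrite lee_fin.
    exact: (@measurable_fun_fubini_tonelli_G _ _ _ _ _ mu _ mah h0).
  - by apply: measurable_funeM; exact/measurable_EFinP.
  - move=> s _; have [sab|sab] := boolP (a <= s <= b); last first.
      rewrite (eq_integral (cst 0%E)) ?integral0 ?mule_ge0// => t _.
      by rewrite /= /h f0E (negbTE sab) !mulr0 normr0.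
    have [as_ sb] := andP sab.
    apply: (@le_trans _ _
      (\int[mu]_(t in `[s, b]) ((M * `|f s|)%:E * (k t s)%:E))%E).
      rewrite [leRHS]integral_mkcond; apply: ge0_le_integral => //.
      + by apply: measurableT_comp => //; apply: measurableT_comp => //;
          exact/measurable_EFinP.
      + apply/(measurable_restrictT _ _).1 => //.
        by apply: measurable_funeM; apply/measurable_EFinP;
          exact: measurable_abel_kernel.
      + move=> t _; rewrite /= patchE mem_setE in_itv/= /h/= kapE f0E G0E sab.
        have [st|st] /= := leP s t; last by rewrite mul0r mulr0 normr0.
        rewrite (le_trans as_ st)/=; case: ifPn => [tb|_].
          rewrite -EFinM lee_fin !normrM (ger0_norm (abel_kernel_ge0 _ _ _)).
          rewrite mulrA mulrAC ler_wpM2r ?abel_kernel_ge0//.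
          by rewrite ler_wpM2r// GM// (le_trans as_ st).
        by rewrite mul0r normr0.
    rewrite ge0_integralZl//; last 2 first.
    - by move=> t _; rewrite lee_fin abel_kernel_ge0.
    - by rewrite lee_fin mulr_ge0.
    - rewrite abel_kernel_integral// subrr powR0 ?gt_eqF// subr0 f0E sab.
      rewrite -!EFinM lee_fin /C mulrAC ler_wpM2r// ler_wpM2l//.
      rewrite ler_wpM2r ?invr_ge0 ?(ltW q0)// ge0_ler_powR ?nnegrE ?subr_ge0//.
      by rewrite ?ltW.
      by rewrite lerD2l lerN2.
    - by apply/measurable_EFinP; exact: measurable_abel_kernel.
rewrite [LHS]Rintegral_mkcond [RHS]Rintegral_mkcond.
under eq_Rintegral do rewrite -hL.
under [RHS]eq_Rintegral do rewrite -hR.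
exact: Rintegral_Fubini.
Qed.

End Volterra.

(** * Continuity of the right fractional potential *)

Section AbelPotential.
Variables (R : realType) (q : R).
Hypothesis q0 : 0 < q.
Local Notation mu := (@lebesgue_measure R).
Implicit Types (a b c d s t : R).
Local Notation k := (abel_kernel q).

Lemma norm_powR_continuous : continuous (fun x : R => `|x| `^ q).
Proof.
move=> x; have [->|x0] := eqVneq x 0.
  apply/cvgrPdist_lt => e e0; rewrite normr0 powR0 ?gt_eqF//.
  apply/nbhs_ballP; exists (e `^ q^-1); first by rewrite /= powR_gt0.
  move=> y; rewrite /ball/= !sub0r !normrN => ye.
  rewrite ger0_norm ?powR_ge0//.
  have -> : e = (e `^ q^-1) `^ q by rewrite -powRrM mulVf ?gt_eqF// powRr1// ltW.
  by rewrite gt0_ltr_powR ?nnegrE ?powR_ge0.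
apply: (@cvg_comp _ _ _ (fun x => `|x|) (@powR R ^~ q) _ (nbhs `|x|)).
  exact: norm_continuous.
have : {for `|x|, continuous (@powR R ^~ q)}.
  apply/differentiable_continuous/derivable1_diffP.
  by apply: ex_derive; apply: is_derive1_powR; rewrite normr_gt0.
exact.
Qed.

(** The power with exponent [q - 1] is monotone on positive numbers, in a direction fixed by the
    sign of [q - 1]. The point [t = s'] is left out: there [powR] takes a default value at base 0,
    which breaks the first comparison when [q < 1]. *)
Lemma abel_kernel_comparable s s' : s <= s' ->
  (forall t, s' < t -> k t s <= k t s') \/ (forall t, s' < t -> k t s' <= k t s).
Proof.
move=> ss'; have [q1|q1] := leP q 1; [left|right] => t st; rewrite /abel_kernel.
  rewrite -(opprB 1 q) !powRN lef_pV2 ?posrE ?powR_gt0 ?subr_gt0//.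
    by rewrite ge0_ler_powR ?nnegrE ?subr_ge0 ?lerD2l ?lerN2// ?ltW//
      (le_lt_trans ss').
  by rewrite (le_lt_trans ss').
by rewrite ge0_ler_powR ?nnegrE ?subr_ge0 ?lerD2l ?lerN2// ?ltW//
  (le_lt_trans ss').
Qed.

Section Bounds.
Variables (a b M : R) (G : R -> R).
Hypothesis mG : measurable_fun `[a, b] G.
Hypothesis GM : forall t, a <= t <= b -> `|G t| <= M.

(** The right Riemann-Liouville integral of order [q], without the factor 1/Gamma(q). *)
Definition abel_potential s := \int[mu]_(t in `[s, b]) (k t s * G t).

Let kG_integrable s c d : a <= c -> s <= c -> c <= d -> d <= b ->
  mu.-integrable `[c, d] (EFin \o (fun t => k t s * G t)).
Proof.
move=> ac sc cd db; apply: (@abel_kernel_mul_integrable _ _ _ _ _ _ _ M) => //.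
- apply: measurable_funS mG => // t; rewrite /= !in_itv/= => /andP[ct td].
  by rewrite (le_trans ac ct) (le_trans td db).
- by move=> t /andP[ct td]; rewrite GM// (le_trans ac ct) (le_trans td db).
Qed.

Let k_integrable s c d : s <= c -> c <= d ->
  mu.-integrable `[c, d] (EFin \o (k ^~ s)).
Proof.
move=> sc cd.
have := @abel_kernel_mul_integrable _ _ q0 s c d (cst 1) 1 sc cd.
rewrite (_ : (fun t => _) = k ^~ s); last by apply/funext => t; rewrite mulr1.
by apply => // t _; rewrite normr1.
Qed.

Lemma Rintegral_abel_kernel s c d : s <= c -> c <= d ->
  \int[mu]_(t in `[c, d]) k t s = ((d - s) `^ q - (c - s) `^ q) / q.
Proof. by move=> sc cd; rewrite /Rintegral abel_kernel_integral. Qed.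

Let M_ge0 c : a <= c <= b -> 0 <= M.
Proof. by move=> /GM; exact: le_trans. Qed.

Let bound_piece s c d : a <= c -> s <= c -> c <= d -> d <= b ->
  `|\int[mu]_(t in `[c, d]) (k t s * G t)| <=
  M * (((d - s) `^ q - (c - s) `^ q) / q).
Proof.
move=> ac sc cd db.
have M0 : 0 <= M by apply: (@M_ge0 c); rewrite ac (le_trans cd).
rewrite (le_trans (le_normr_Rintegral _ _))//; first exact: kG_integrable.
rewrite -Rintegral_abel_kernel// -RintegralZl//; last exact: k_integrable.
apply: le_Rintegral => //.
- by apply: integrable_EFin_norm; exact: kG_integrable.
- by apply: integrable_EFinZ => //; exact: k_integrable.
- move=> t; rewrite /= in_itv/= => /andP[ct td].
  rewrite normrM (ger0_norm (abel_kernel_ge0 _ _ _)) mulrC.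
  by rewrite ler_wpM2r ?abel_kernel_ge0// GM// (le_trans ac ct) (le_trans td db).
Qed.

Let bound_diff s s' : a <= s -> s <= s' -> s' <= b ->
  `|\int[mu]_(t in `[s', b]) (k t s * G t - k t s' * G t)| <=
  M * `|((b - s) `^ q - (s' - s) `^ q) / q - (b - s') `^ q / q|.
Proof.
move=> as_ ss' s'b; have as' := le_trans as_ ss'.
have M0 : 0 <= M by apply: (@M_ge0 s'); rewrite as'.
have iB : mu.-integrable `[s', b] (EFin \o (fun t => k t s * G t - k t s' * G t)).
  by apply: integrable_EFinB => //; exact: kG_integrable.
have ik : mu.-integrable `[s', b] (EFin \o (fun t => k t s - k t s')).
  by apply: integrable_EFinB => //; exact: k_integrable.
have ikoc : mu.-integrable `]s', b] (EFin \o (fun t => k t s - k t s')).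
  apply: integrableS ik => // t; rewrite /= !in_itv/= => /andP[/ltW-> ->]//.
rewrite (le_trans (le_normr_Rintegral _ iB))//.
have -> : ((b - s) `^ q - (s' - s) `^ q) / q - (b - s') `^ q / q =
    \int[mu]_(t in `[s', b]) (k t s - k t s').
  rewrite RintegralB//; [|exact: k_integrable|exact: k_integrable].
  by rewrite !Rintegral_abel_kernel// subrr powR0 ?gt_eqF// subr0.
have <- : \int[mu]_(t in `]s', b]) `|k t s - k t s'| =
    `|\int[mu]_(t in `[s', b]) (k t s - k t s')|.
  rewrite -(Rintegral_itv_obnd_cbnd ikoc).
  have [kle|kle] := abel_kernel_comparable ss'.
  - rewrite ler0_norm.
      rewrite -mulN1r -RintegralZl//; apply: eq_Rintegral => t.
      rewrite inE/= in_itv/= => /andP[st _].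
      by rewrite mulN1r ler0_norm// subr_le0 kle.
    rewrite -oppr_ge0 -mulN1r -RintegralZl//; apply: Rintegral_ge0 => t /=.
    by rewrite in_itv/= => /andP[st _]; rewrite mulN1r opprB subr_ge0 kle.
  - rewrite ger0_norm.
      apply: eq_Rintegral => t; rewrite inE/= in_itv/= => /andP[st _].
      by rewrite ger0_norm// subr_ge0 kle.
    apply: Rintegral_ge0 => t /=.
    by rewrite in_itv/= => /andP[st _]; rewrite subr_ge0 kle.
have ian : mu.-integrable `[s', b] (EFin \o (fun t => `|k t s - k t s'|)).
  exact: integrable_EFin_norm.
rewrite Rintegral_itv_obnd_cbnd; last first.
  apply: integrableS ian => // t; rewrite /= !in_itv/= => /andP[/ltW-> ->]//.
rewrite -RintegralZl//; apply: le_Rintegral => //.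
- exact: integrable_EFin_norm.
- exact: integrable_EFinZ.
- move=> t; rewrite /= in_itv/= => /andP[ct td].
  by rewrite -mulrBl normrM mulrC ler_wpM2r// GM// (le_trans as' ct).
Qed.

(* The difference of two kernels has a constant sign, so that its L^1 norm is
   the absolute value of an explicit integral. *)
Lemma abel_potential_holder s s' : a <= s -> s <= s' -> s' <= b ->
  `|abel_potential s - abel_potential s'| <=
  M / q * (`|s' - s| `^ q *+ 2 + `| `|b - s| `^ q - `|b - s'| `^ q|).
Proof.
move=> as_ ss' s'b; have as' := le_trans as_ ss'; have sb := le_trans ss' s'b.
have M0 : 0 <= M by apply: (@M_ge0 s'); rewrite as'.
have E : abel_potential s - abel_potential s' =
   \int[mu]_(t in `[s, s']) (k t s * G t) +
   \int[mu]_(t in `[s', b]) (k t s * G t - k t s' * G t).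
  rewrite RintegralB//; [|exact: kG_integrable|exact: kG_integrable].
  rewrite addrA; congr (_ - _).
  have := kG_integrable as' ss' s'b (lexx b) => iG.
  rewrite -(Rintegral_itv_obnd_cbnd (r := s')); last first.
    by apply: integrableS iG => // t; rewrite /= !in_itv/= => /andP[/ltW-> ->].
  rewrite -(@Rintegral_itvB _ (fun t => k t s * G t) (BLeft s) (BRight b) s').
  - by rewrite addrC subrK.
  - exact: kG_integrable.
  - by rewrite bnd_simp.
  - by rewrite bnd_simp.
rewrite E (le_trans (ler_normD _ _))//.
rewrite (le_trans (lerD (bound_piece _ _ _ _) (bound_diff _ _ _)))//.
rewrite subrr powR0 ?gt_eqF// subr0.
have qV0 : 0 <= q^-1 by rewrite invr_ge0 ltW.
have [h1 h2 h3] : [/\ 0 <= s' - s, 0 <= b - s & 0 <= b - s'] by rewrite !subr_ge0.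
rewrite -mulrBl normrM (ger0_norm qV0) (ger0_norm h1) (ger0_norm h2) (ger0_norm h3).
set x := (s' - s) `^ q; set y := (b - s) `^ q; set z := (b - s') `^ q.
have -> : y - x - z = (y - z) - x by ring.
have -> : M * (x / q) + M * (`|y - z - x| / q) = M / q * (x + `|y - z - x|) by ring.
have -> : x *+ 2 + `|y - z| = x + (`|y - z| + x) by ring.
have Mq0 : 0 <= M / q by rewrite mulr_ge0.
rewrite (ler_wpM2l Mq0)// lerD2l (le_trans (ler_normB _ _))// lerD2l.
by rewrite ger0_norm// powR_ge0.
Qed.

(** The bound of [abel_potential_holder] is continuous in [s'] and vanishes at [s' = s]; the
    absolute values in it let [s'] approach from either side. *)
Lemma abel_potential_continuous : {within `[a, b], continuous abel_potential}.
Proof.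
have H s s' : a <= s <= b -> a <= s' <= b ->
  `|abel_potential s - abel_potential s'| <=
  M / q * (`|s' - s| `^ q *+ 2 + `| `|b - s| `^ q - `|b - s'| `^ q|).
  move=> /andP[as_ sb] /andP[as' s'b]; have [ss'|/ltW s's] := leP s s'.
    exact: abel_potential_holder.
  by rewrite distrC (distrC s') (distrC (_ `^ _)); exact: abel_potential_holder.
apply/subspace_continuousP => s; rewrite /= in_itv/= => sab.
pose w s' := M / q * (`|s' - s| `^ q *+ 2 + `| `|b - s| `^ q - `|b - s'| `^ q|).
have cw : w s' @[s' --> s] --> 0.
  have -> : 0 = w s :> R.
    by rewrite /w !subrr !normr0 powR0 ?gt_eqF// mul0rn addr0 mulr0.
  apply: cvgMl_tmp; apply: cvgD.
    apply: cvgMn.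
    apply: (@continuous_comp _ _ _ (fun s' => s' - s) (fun x => `|x| `^ q)).
      by apply: cvgB; [exact: cvg_id|exact: cvg_cst].
    exact: norm_powR_continuous.
  apply: cvg_norm; apply: cvgB; first exact: cvg_cst.
  apply: (@continuous_comp _ _ _ (fun s' => b - s') (fun x => `|x| `^ q)).
    by apply: cvgB; [exact: cvg_cst|exact: cvg_id].
  exact: norm_powR_continuous.
apply/cvgrPdist_le => /= e e0; rewrite near_withinE.
have /cvgr0_norm_le/(_ _ e0) := cw.
apply: filterS => s' ws' /=; rewrite in_itv/= => s'ab.
by rewrite (le_trans (H _ _ sab s'ab))// (le_trans _ ws')// ler_norm.
Qed.

End Bounds.

End AbelPotential.

(** * Fractional integration by parts *)

Section WithinContinuous.
Variable R : realType.
Local Notation mu := (@lebesgue_measure R).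
Implicit Types (a b s t : R) (f g : R -> R).

Lemma within_continuousD (A : set R) f g : {within A, continuous f} ->
  {within A, continuous g} -> {within A, continuous (fun t => f t + g t)}.
Proof. by move=> cf cg t; apply: cvgD; [exact: cf|exact: cg]. Qed.

Lemma within_continuousB (A : set R) f g : {within A, continuous f} ->
  {within A, continuous g} -> {within A, continuous (fun t => f t - g t)}.
Proof. by move=> cf cg t; apply: cvgB; [exact: cf|exact: cg]. Qed.

Lemma within_continuousM (A : set R) f g : {within A, continuous f} ->
  {within A, continuous g} -> {within A, continuous (fun t => f t * g t)}.
Proof. by move=> cf cg t; apply: cvgM; [exact: cf|exact: cg]. Qed.

Lemma within_continuousZ (A : set R) c f : {within A, continuous f} ->
  {within A, continuous (fun t => c * f t)}.
Proof. by move=> cf t; apply: cvgMl_tmp; exact: cf. Qed.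

Lemma eq_within_continuous (A : set R) f g : {within A, continuous f} ->
  {in A, f =1 g} -> {within A, continuous g}.
Proof. by move=> cf fg; exact: subspace_eq_continuous fg cf. Qed.

Lemma within_continuous_sub a b s f : a <= s -> {within `[a, b], continuous f} ->
  {within `[s, b], continuous f}.
Proof.
move=> as_; apply: continuous_subspaceW => t; rewrite /= !in_itv/=.
by move=> /andP[st ->]; rewrite (le_trans as_ st).
Qed.

Lemma within_continuous_integrable a b f : {within `[a, b], continuous f} ->
  mu.-integrable `[a, b] (EFin \o f).
Proof. by apply: continuous_compact_integrable; exact: segment_compact. Qed.

Lemma within_continuous_measurable a b f : {within `[a, b], continuous f} ->
  measurable_fun `[a, b] f.
Proof. by move=> /within_continuous_integrable/integrableP[/measurable_EFinP]. Qed.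

Lemma within_continuous_bounded a b f : {within `[a, b], continuous f} ->
  exists M, forall t, a <= t <= b -> `|f t| <= M.
Proof.
move=> cf.
have /compact_bounded[M [_ H]] := continuous_compact cf (@segment_compact _ a b).
exists (M + 1) => t tab; apply: (H (M + 1)); first by rewrite ltrDl.
by exists t => //=; rewrite in_itv.
Qed.

Lemma within_continuous_comp4 (A : set R) (F : R -> R -> R -> R -> R) f1 f2 f3 :
  continuous (unc4 F) -> {within A, continuous f1} ->
  {within A, continuous f2} -> {within A, continuous f3} ->
  {within A, continuous (fun t => F t (f1 t) (f2 t) (f3 t))}.
Proof.
move=> cF c1 c2 c3; have cid : {within A, continuous (@idfun R)}.
  by apply: continuous_subspaceT => t; exact: cvg_id.
move=> t; pose p s : R * R * R * R := (s, f1 s, f2 s, f3 s).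
apply: (@cvg_comp _ _ _ p (unc4 F) _ (nbhs (p t))); last exact: (cF (p t)).
exact: (cvg_pair (cvg_pair (cvg_pair (cid t) (c1 t)) (c2 t)) (c3 t)).
Qed.

Lemma within_continuous_comp5 (A : set R) (F : R -> R -> R -> R -> R -> R)
    f1 f2 f3 f4 :
  continuous (unc5 F) -> {within A, continuous f1} ->
  {within A, continuous f2} -> {within A, continuous f3} ->
  {within A, continuous f4} ->
  {within A, continuous (fun t => F t (f1 t) (f2 t) (f3 t) (f4 t))}.
Proof.
move=> cF c1 c2 c3 c4; have cid : {within A, continuous (@idfun R)}.
  by apply: continuous_subspaceT => t; exact: cvg_id.
move=> t; pose p s : R * R * R * R * R := (s, f1 s, f2 s, f3 s, f4 s).
apply: (@cvg_comp _ _ _ p (unc5 F) _ (nbhs (p t))); last exact: (cF (p t)).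
exact: (cvg_pair
  (cvg_pair (cvg_pair (cvg_pair (cid t) (c1 t)) (c2 t)) (c3 t)) (c4 t)).
Qed.

End WithinContinuous.

(** * Caputo derivatives through densities, and integration by parts *)

Section CaputoDensity.
Variable R : realType.
Local Notation mu := (@lebesgue_measure R).
Implicit Types (a b s t : R) (f g : R -> R).

(* [derive1 x] has junk values where [x] is not differentiable: it agrees with
   the density [f] only almost everywhere. *)
Lemma caputo_density alpha a b x : a < b -> abs_cont_on a b x ->
  (forall t, a <= t <= b ->
     mu.-integrable `[a, t] (EFin \o caputo_kernel alpha x t)) ->
  exists f, [/\ mu.-integrable setT (EFin \o f),
    forall t, a <= t <= b -> x t = x a + \int[mu]_(s in `[a, t]) f s &
    forall t, a <= t <= b ->
      mu.-integrable `[a, t]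
        (EFin \o (fun s => abel_kernel (1 - alpha) t s * f s)) /\
      caputoD alpha a x t = (Gamma (1 - alpha))^-1 *
        \int[mu]_(s in `[a, t]) (abel_kernel (1 - alpha) t s * f s)].
Proof.
move=> ab acx ik; have [f fi [fE xf]] := abs_cont_FTC ab acx.
exists f; split => // t tab; have /andP[at_ tb] := tab.
have ckE s : derive1 x s = f s ->
    caputo_kernel alpha x t s = abel_kernel (1 - alpha) t s * f s.
  move=> <-; rewrite /caputo_kernel /abel_kernel; congr (_ `^ _ * _).
  by ring.
have aeE : ae_eq mu `[a, t]%classic (EFin \o caputo_kernel alpha x t)
    (EFin \o (fun s => abel_kernel (1 - alpha) t s * f s)).
  apply: (@filterS _ _ (ae_filter_ringOfSetsType mu)) xf => s /= + sat.
  move=> xfs; rewrite ckE// xfs//; move: sat; rewrite /= !in_itv/=.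
  by move=> /andP[-> /le_trans]; apply.
have mk : measurable_fun `[a, t] (EFin \o caputo_kernel alpha x t).
  by have /integrableP[] := ik t tab.
have mkf : measurable_fun `[a, t]
    (EFin \o (fun s => abel_kernel (1 - alpha) t s * f s)).
  apply/measurable_EFinP; apply: measurable_funM.
    exact: measurable_abel_kernelr.
  by apply: measurable_funTS; have /integrableP[/measurable_EFinP] := fi.
split; last by congr (_ * fine _); exact: ae_eq_integral aeE.
apply/integrableP; split => //.
have /integrableP[_] := ik t tab; apply: le_lt_trans.
rewrite le_eqVlt; apply/orP; left; apply/eqP/esym.
apply: ae_eq_integral => //.
- exact: measurableT_comp.
- exact: measurableT_comp.
- exact: ae_eq_abse.
Qed.

Lemma derive1_scaled_sum c f g t : derivable f t 1 -> derivable g t 1 ->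
  derivable (fun s => c * (f s + g s)) t 1 /\
  derive1 (fun s => c * (f s + g s)) t = c * (derive1 f t + derive1 g t).
Proof.
move=> df dg; have dfg := derivableD df dg.
have -> : (fun s => c * (f s + g s)) = c \*: (f + g) by [].
split; first exact: derivableZ.
by rewrite !derive1E deriveZ// deriveD.
Qed.

Lemma abel_kernel1 t s : abel_kernel 1 t s = 1 :> R.
Proof. by rewrite /abel_kernel subrr powRr0. Qed.

(** The case [q = 1] of [volterra_fubini]: the kernel is 1 everywhere, even on the diagonal, as
    [powR] gives 1 for exponent 0. *)
Lemma Rintegral_triangle a b (f G : R -> R) : a <= b ->
  mu.-integrable `[a, b] (EFin \o f) -> {within `[a, b], continuous G} ->
  \int[mu]_(t in `[a, b]) (G t * \int[mu]_(s in `[a, t]) f s) =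
  \int[mu]_(s in `[a, b]) (f s * \int[mu]_(t in `[s, b]) G t).
Proof.
move=> ab fi cG; have [M GM] := within_continuous_bounded cG.
have e1 t : (fun s => abel_kernel 1 t s * f s) = f.
  by apply/funext => s; rewrite abel_kernel1 mul1r.
have e2 s : (fun t => abel_kernel 1 t s * G t) = G.
  by apply/funext => t; rewrite abel_kernel1 mul1r.
have kfi t : a <= t <= b ->
    mu.-integrable `[a, t] (EFin \o (fun s => abel_kernel 1 t s * f s)).
  rewrite e1 => /andP[at_ tb]; apply: integrableS fi => // s.
  by rewrite /= !in_itv/= => /andP[-> /le_trans]; apply.
have := volterra_fubini ltr01 ab fi kfi (within_continuous_measurable cG) GM.
under eq_Rintegral do rewrite e1.
by under [X in _ = X -> _]eq_Rintegral do rewrite e2.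
Qed.

(** The derivative is known only in the open interval; continuity of [r] and [C] up to the end
    points makes the fundamental theorem applicable. *)
Lemma within_continuous_primitive a b r C s : a <= s <= b ->
  {within `[a, b], continuous r} -> {within `[a, b], continuous C} ->
  (forall t, a < t < b -> derivable r t 1 /\ derive1 r t = C t) ->
  \int[mu]_(t in `[s, b]) C t = r b - r s.
Proof.
move=> /andP[as_]; rewrite le_eqVlt => /predU1P[->|sb] cr cC dr.
  by rewrite set_itv1 Rintegral_set1 subrr.
have csr := within_continuous_sub as_ cr.
have [cro crl crr] := (continuous_within_itvP _ sb).1 csr.
rewrite /Rintegral (@continuous_FTC2 _ _ r)//.
- exact: within_continuous_sub cC.
- split => // t; rewrite in_itv/= => /andP[st tb].
  by apply: (dr t _).1; rewrite (le_lt_trans as_ st).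
- move=> t; rewrite in_itv/= => /andP[st tb].
  by apply: (dr t _).2; rewrite (le_lt_trans as_ st).
Qed.

(** Here [f] stands for the derivative of [eta]. Fubini turns the left side into the integral of
    [f * r]; writing [r s] as [r b] minus the integral of [C] over [[s, b]], the first part gives
    [r b * eta b = 0] and a second Fubini turns the rest into the right side. *)
Lemma fractional_integration_by_parts q c a b (eta f G r C : R -> R) :
  0 < q -> a < b ->
  mu.-integrable `[a, b] (EFin \o f) ->
  (forall t, a <= t <= b -> eta t = \int[mu]_(s in `[a, t]) f s) -> eta b = 0 ->
  (forall t, a <= t <= b ->
     mu.-integrable `[a, t] (EFin \o (fun s => abel_kernel q t s * f s))) ->
  {within `[a, b], continuous G} -> {within `[a, b], continuous C} ->
  (forall s, a <= s <= b -> r s = c * abel_potential q b G s) ->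
  (forall t, a < t < b -> derivable r t 1 /\ derive1 r t = C t) ->
  \int[mu]_(t in `[a, b])
    (G t * (c * \int[mu]_(s in `[a, t]) (abel_kernel q t s * f s))) =
  - \int[mu]_(t in `[a, b]) (C t * eta t).
Proof.
move=> q0 ab fi etaE etab kfi cG cC rE dr.
have [M GM] := within_continuous_bounded cG.
have mG := within_continuous_measurable cG.
have cK := abel_potential_continuous q0 mG GM.
have cr : {within `[a, b], continuous r}.
  apply: (eq_within_continuous (within_continuousZ (c := c) cK)).
  by move=> s; rewrite inE/= in_itv/= => /rE ->.
have rP s : a <= s <= b -> r s = r b - \int[mu]_(t in `[s, b]) C t.
  by move=> sab; rewrite (within_continuous_primitive sab cr cC dr); ring.
have cP : {within `[a, b], continuous (fun s => \int[mu]_(t in `[s, b]) C t)}.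
  have crb : {within `[a, b], continuous (fun s => r b - r s)}.
    by apply: within_continuousB => //; exact: cst_continuous.
  apply: (eq_within_continuous crb).
  by move=> s; rewrite inE/= in_itv/= => /rP ->; ring.
have fiM (h : R -> R) : {within `[a, b], continuous h} ->
    mu.-integrable `[a, b] (EFin \o (fun s => f s * h s)).
  move=> ch; have [N hN] := within_continuous_bounded ch.
  have iN : mu.-integrable `[a, b] (EFin \o (fun s => N * f s)).
    exact: integrable_EFinZ.
  apply: le_integrable iN => //.
    apply/measurable_EFinP; apply: measurable_funM.
      by have /integrableP[/measurable_EFinP] := fi.
    exact: within_continuous_measurable.
  move=> s; rewrite /= in_itv/= => sab; rewrite lee_fin !normrM mulrC.
  by rewrite ler_wpM2r// (le_trans (hN _ sab))// ler_norm.
transitivity (\int[mu]_(s in `[a, b]) (f s * r s)).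
  have cfi : mu.-integrable `[a, b] (EFin \o (fun s => c * f s)).
    exact: integrable_EFinZ.
  have kcE t : (fun s => abel_kernel q t s * (c * f s)) =
      (fun s => c * (abel_kernel q t s * f s)).
    by apply/funext => s; ring.
  have kcfi t : a <= t <= b ->
      mu.-integrable `[a, t] (EFin \o (fun s => abel_kernel q t s * (c * f s))).
    by move=> tab; rewrite kcE; apply: integrable_EFinZ => //; exact: kfi.
  transitivity (\int[mu]_(t in `[a, b])
      (G t * \int[mu]_(s in `[a, t]) (abel_kernel q t s * (c * f s)))).
    apply: eq_Rintegral => t; rewrite inE/= in_itv/= => tab.
    by rewrite kcE RintegralZl//; exact: kfi.
  rewrite (volterra_fubini q0 (ltW ab) cfi kcfi mG GM).
  apply: eq_Rintegral => s; rewrite inE/= in_itv/= => /rE ->.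
  by rewrite /abel_potential; ring.
transitivity (\int[mu]_(s in `[a, b])
    (r b * f s - f s * \int[mu]_(t in `[s, b]) C t)).
  by apply: eq_Rintegral => s; rewrite inE/= in_itv/= => /rP ->; ring.
rewrite RintegralB//; [|exact: integrable_EFinZ|exact: fiM].
rewrite RintegralZl// -etaE ?lexx ?(ltW ab)// etab mulr0 sub0r; congr (- _).
rewrite -Rintegral_triangle ?(ltW ab)//.
by apply: eq_Rintegral => t; rewrite inE/= in_itv/= => /etaE ->.
Qed.

End CaputoDensity.

(** * Sufficiency of the Euler-Lagrange equation *)

Section Trajectory.
Variables (R : realType) (alpha beta a b : R) (l : R -> R -> R -> R -> R).
Variable x : R -> R.
Hypotheses (ab : a < b) (cl : continuous (unc4 l)) (Fx : classF alpha beta a b x).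
Local Notation mu := (@lebesgue_measure R).

Lemma classF_continuous : {within `[a, b], continuous x}.
Proof.
by case: Fx => acx _ _ _ _;
  exact/seq_abs_cont_within_continuous/abs_cont_on_seq.
Qed.

Lemma along4_continuous (F : R -> R -> R -> R -> R) : continuous (unc4 F) ->
  {within `[a, b], continuous (along4 alpha beta a F x)}.
Proof.
by move=> cF; case: (Fx) => _ _ cD _ cI; apply: within_continuous_comp4 => //;
  exact: classF_continuous.
Qed.

Lemma zfun_continuous : {within `[a, b], continuous (zfun alpha beta a l x)}.
Proof.
apply: parameterized_integral_continuous; first exact: ltW.
exact/within_continuous_integrable/along4_continuous.
Qed.

Lemma along5_continuous (F : R -> R -> R -> R -> R -> R) :
  continuous (unc5 F) ->
  {within `[a, b], continuous (along5 alpha beta a l F x)}.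
Proof.
move=> cF; case: (Fx) => _ _ cD _ cI; apply: within_continuous_comp5 => //.
  exact: classF_continuous.
exact: zfun_continuous.
Qed.

End Trajectory.

Theorem theorem10p10 (R : realType) (alpha beta a b xa xb : R)
  (L : R -> R -> R -> R -> R -> R) (l : R -> R -> R -> R -> R) (x : R -> R) :
  0 < alpha < 1 -> 0 < beta -> a < b ->
  C1_5 L -> C1_4 l ->
  classF alpha beta a b x -> x a = xa -> x b = xb ->
  let Lz := along5 alpha beta a l (dL5 L) x in
  let P := fun s => \int[@lebesgue_measure R]_(tau in `[s, b]) Lz tau in
  let gv := along5 alpha beta a l (dL3 L) x in
  let gw := along5 alpha beta a l (dL4 L) x in
  let hv := fun s => P s * along4 alpha beta a (dl3 l) x s in
  let hw := fun s => P s * along4 alpha beta a (dl4 l) x s in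
  (forall t, a < t < b ->
     derivable (rRL_aux alpha b gv) t 1 /\ derivable (rRL_aux alpha b hv) t 1) ->
  (forall t, a < t < b ->
     along5 alpha beta a l (dL2 L) x t + rRLD alpha b gv t + fracIr beta b gw t
     + P t * along4 alpha beta a (dl2 l) x t
     + rRLD alpha b hv t + fracIr beta b hw t = 0) ->
  convex_L_xvwz L ->
  ((convex_l_xvw l /\ (forall t, a <= t <= b -> 0 <= Lz t)) \/
   (concave_l_xvw l /\ (forall t, a <= t <= b -> Lz t <= 0))) ->
  forall y : R -> R, classF alpha beta a b y -> y a = xa -> y b = xb ->
    Jfun alpha beta a b L l x <= Jfun alpha beta a b L l y.
Proof.
move=> /andP[alpha0 alpha1] beta0 ab CL Cl Fx xaE xbE Lz P gv gw hv hw dR EL.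
move=> cvxL cvxl y Fy yaE ybE.
have ab' := ltW ab.
have q0 : 0 < 1 - alpha by rewrite subr_gt0.
have [_ [cL [_ cL2 cL3 cL4 cL5]]] := CL.
have [_ [cl _ cl2 cl3 cl4]] := Cl.
pose c2 := (Gamma beta)^-1; pose c1 := (Gamma (1 - alpha))^-1.
pose Lx := along5 alpha beta a l (dL2 L) x.
pose lx := along4 alpha beta a (dl2 l) x.
pose lv := along4 alpha beta a (dl3 l) x.
pose lw := along4 alpha beta a (dl4 l) x.
have cLx : {within `[a, b], continuous Lx} by exact: along5_continuous.
have cgv : {within `[a, b], continuous gv} by exact: along5_continuous.
have cgw : {within `[a, b], continuous gw} by exact: along5_continuous.
have cLz : {within `[a, b], continuous Lz} by exact: along5_continuous.
have clx : {within `[a, b], continuous lx} by exact: along4_continuous.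
have clv : {within `[a, b], continuous lv} by exact: along4_continuous.
have clw : {within `[a, b], continuous lw} by exact: along4_continuous.
have cP : {within `[a, b], continuous P}.
  have [M LzM] := within_continuous_bounded cLz.
  have mLz := within_continuous_measurable cLz.
  apply: (eq_within_continuous (abel_potential_continuous ltr01 mLz LzM)).
  move=> s _; apply: eq_Rintegral => t _.
  by rewrite abel_kernel1 mul1r.
have chv : {within `[a, b], continuous hv} by exact: (within_continuousM cP clv).
have chw : {within `[a, b], continuous hw} by exact: (within_continuousM cP clw).
pose eta t := y t - x t.
pose dv t := caputoD alpha a y t - caputoD alpha a x t.
pose dw t := fracIl beta a y t - fracIl beta a x t.
pose dz t := zfun alpha beta a l y t - zfun alpha beta a l x t.
have [acx ikx cDx iIx cIx] := Fx; have [acy iky cDy iIy cIy] := Fy.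
have ceta : {within `[a, b], continuous eta}.
  exact: (within_continuousB (classF_continuous Fy) (classF_continuous Fx)).
have cdv : {within `[a, b], continuous dv} by exact: (within_continuousB cDy cDx).
have cdw : {within `[a, b], continuous dw} by exact: (within_continuousB cIy cIx).
(* Linearization of [l] along [x] in the direction [y - x]; its primitive [Q] is the linearized
   increment of [z], to be compared with the true increment [dz]. *)
pose q t := lx t * eta t + lv t * dv t + lw t * dw t.
have cq : {within `[a, b], continuous q}.
  exact: (within_continuousD (within_continuousD (within_continuousM clx ceta)
    (within_continuousM clv cdv)) (within_continuousM clw cdw)).
pose Q t := \int[@lebesgue_measure R]_(s in `[a, t]) q s.
have cQ : {within `[a, b], continuous Q}.
  apply: parameterized_integral_continuous => //.
  exact: within_continuous_integrable.
have subint (f : R -> R) t : a <= t <= b -> {within `[a, b], continuous f} ->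
    (@lebesgue_measure R).-integrable `[a, t] (EFin \o f).
  move=> /andP[at_ tb] /within_continuous_integrable; apply: integrableS => //.
  by move=> s; rewrite /= !in_itv/= => /andP[-> /le_trans]; apply.
(* Convexity gives [Q <= dz] and concavity the reverse; the sign of [Lz] makes the product
   inequality the same in both cases. *)
have dzQ t : a <= t <= b -> Lz t * Q t <= Lz t * dz t.
  move=> tab.
  have cly := along4_continuous Fy cl; have clx' := along4_continuous Fx cl.
  have dzE : dz t = \int[@lebesgue_measure R]_(s in `[a, t])
      (along4 alpha beta a l y s - along4 alpha beta a l x s).
    by rewrite RintegralB//; exact: subint.
  have clB := within_continuousB cly clx'.
  case: cvxl => [[cvx Lz0]|[ccv Lz0]].
    rewrite ler_wpM2l ?Lz0// dzE; apply: le_Rintegral => //.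
    - exact: subint.
    - exact: subint.
    - move=> s _; have := cvx s (x s) (caputoD alpha a x s) (fracIl beta a x s)
        (eta s) (dv s) (dw s).
      by rewrite !subrKC.
  rewrite ler_wnM2l ?Lz0// dzE; apply: le_Rintegral => //.
  - exact: subint.
  - exact: subint.
  - move=> s _; have := ccv s (x s) (caputoD alpha a x s) (fracIl beta a x s)
      (eta s) (dv s) (dw s).
    by rewrite !subrKC.
pose W t := Lx t * eta t + gv t * dv t + gw t * dw t.
have cW : {within `[a, b], continuous W}.
  exact: (within_continuousD (within_continuousD (within_continuousM cLx ceta)
    (within_continuousM cgv cdv)) (within_continuousM cgw cdw)).
have cLzQ : {within `[a, b], continuous (fun t => Lz t * Q t)}.
  exact: (within_continuousM cLz cQ).
have bab : a <= b <= b by rewrite ab' lexx.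
have cLy := along5_continuous ab cl Fy cL.
have cLx' := along5_continuous ab cl Fx cL.
rewrite -subr_ge0 /Jfun -RintegralB//; [|exact: subint|exact: subint].
(* It remains to show that this lower bound, the first variation with [dz] replaced by [Q], is
   nonnegative; it is in fact 0. *)
apply: (@le_trans _ _ (\int[@lebesgue_measure R]_(t in `[a, b])
    (W t + Lz t * Q t))); last first.
  apply: le_Rintegral => //.
  - exact: (subint _ _ bab (within_continuousD cW cLzQ)).
  - exact: (subint _ _ bab (within_continuousB cLy cLx')).
  - move=> t; rewrite /= in_itv/= => tab.
    have := cvxL t (x t) (caputoD alpha a x t) (fracIl beta a x t)
      (zfun alpha beta a l x t) (eta t) (dv t) (dw t) (dz t).
    rewrite !subrKC; apply: le_trans.
    by rewrite lerD2l dzQ.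
(* Coefficients of [eta], [dv] and [dw] once the [z] term has been absorbed into the weight [P].
   [Gw] also carries the factor 1/Gamma(beta), so that its potential [K] is a sum of right
   fractional integrals. *)
pose A t := Lx t + P t * lx t.
pose Gv t := gv t + hv t; pose Gw t := c2 * (gw t + hw t).
have cA : {within `[a, b], continuous A}.
  exact: (within_continuousD cLx (within_continuousM cP clx)).
have cGv : {within `[a, b], continuous Gv} by exact: (within_continuousD cgv chv).
have cGw : {within `[a, b], continuous Gw}.
  exact: (within_continuousZ (within_continuousD cgw chw)).
have [M GwM] := within_continuous_bounded cGw.
have mGw := within_continuous_measurable cGw.
pose K := abel_potential beta b Gw.
have cK : {within `[a, b], continuous K}.
  exact: (abel_potential_continuous beta0 mGw GwM).
(* The Euler-Lagrange equation will identify [C] with the derivative of [r]; unlike that derivative,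
   it is known to be continuous on the closed interval. *)
pose C t := A t + K t.
have cC : {within `[a, b], continuous C} by exact: (within_continuousD cA cK).
have [fx [fxi xE kx]] := caputo_density ab acx ikx.
have [fy [fyi yE ky]] := caputo_density ab acy iky.
pose f s := fy s - fx s.
have fiT : (@lebesgue_measure R).-integrable setT (EFin \o f).
  exact: integrable_EFinB.
have fi : (@lebesgue_measure R).-integrable `[a, b] (EFin \o f).
  by apply: integrableS fiT.
have etaE t : a <= t <= b ->
    eta t = \int[@lebesgue_measure R]_(s in `[a, t]) f s.
  move=> tab; rewrite /eta xE// yE// yaE -xaE RintegralB//.
  - by ring.
  - by apply: integrableS fyi.
  - by apply: integrableS fxi.
have kfE t : (fun s => abel_kernel (1 - alpha) t s * f s) =
    (fun s => abel_kernel (1 - alpha) t s * fy s -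
              abel_kernel (1 - alpha) t s * fx s).
  by apply/funext => s; rewrite -mulrBr.
have kfi t : a <= t <= b -> (@lebesgue_measure R).-integrable `[a, t]
    (EFin \o (fun s => abel_kernel (1 - alpha) t s * f s)).
  move=> tab; rewrite kfE; apply: integrable_EFinB => //.
    by have [] := ky t tab.
  by have [] := kx t tab.
have dvE t : a <= t <= b -> dv t =
    c1 * \int[@lebesgue_measure R]_(s in `[a, t])
      (abel_kernel (1 - alpha) t s * f s).
  move=> tab; have [kxi xD] := kx t tab; have [kyi yD] := ky t tab.
  by rewrite /dv xD yD kfE RintegralB// mulrBr.
have kbE t : (fun s => abel_kernel beta t s * eta s) =
    (fun s => abel_kernel beta t s * y s - abel_kernel beta t s * x s).
  by apply/funext => s; rewrite -mulrBr.
have kbi t : a <= t <= b -> (@lebesgue_measure R).-integrable `[a, t]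
    (EFin \o (fun s => abel_kernel beta t s * eta s)).
  move=> tab; rewrite kbE; apply: integrable_EFinB => //.
    exact: iIy.
  exact: iIx.
have dwE t : a <= t <= b -> dw t =
    c2 * \int[@lebesgue_measure R]_(s in `[a, t]) (abel_kernel beta t s * eta s).
  move=> tab; rewrite kbE RintegralB//; [|exact: iIy|exact: iIx].
  by rewrite mulrBr.
have intw : \int[@lebesgue_measure R]_(t in `[a, b]) ((gw t + hw t) * dw t) =
    \int[@lebesgue_measure R]_(s in `[a, b]) (K s * eta s).
  transitivity (\int[@lebesgue_measure R]_(s in `[a, b]) (eta s * K s)).
    rewrite -(volterra_fubini beta0 ab' (within_continuous_integrable ceta) kbi
      mGw GwM).
    apply: eq_Rintegral => t; rewrite inE/= in_itv/= => /dwE ->.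
    by rewrite /Gw; ring.
  by apply: eq_Rintegral => s _; rewrite mulrC.
(* The two potentials stay separate because each is assumed derivable; [rE] joins them into the
   single potential of [Gv]. *)
pose r s := c1 * (rRL_aux alpha b gv s + rRL_aux alpha b hv s).
have kint p (g : R -> R) s : 0 < p -> a <= s <= b ->
    {within `[a, b], continuous g} ->
    (@lebesgue_measure R).-integrable `[s, b]
      (EFin \o (fun t => abel_kernel p t s * g t)).
  move=> p0 /andP[as_ sb] cg; have [N gN] := within_continuous_bounded cg.
  apply: (@abel_kernel_mul_integrable _ _ p0 _ _ _ _ N) => //.
    exact: (within_continuous_measurable (within_continuous_sub as_ cg)).
  by move=> t /andP[st tb]; rewrite gN// (le_trans as_ st).
have rE s : a <= s <= b -> r s = c1 * abel_potential (1 - alpha) b Gv s.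
  move=> sab; congr (_ * _); rewrite /abel_potential.
  have rauxE g : rRL_aux alpha b g s =
      \int[@lebesgue_measure R]_(t in `[s, b]) (abel_kernel (1 - alpha) t s * g t).
    apply: eq_Rintegral => t _; congr (_ `^ _ * _).
    by ring.
  rewrite !rauxE -RintegralD//; [|exact: kint|exact: kint].
  by apply: eq_Rintegral => t _; rewrite mulrDr.
have KE t : a <= t <= b -> K t = fracIr beta b gw t + fracIr beta b hw t.
  move=> tab; rewrite /fracIr -mulrDr -RintegralD//; [|exact: kint|exact: kint].
  rewrite -RintegralZl//; last first.
    by apply: integrable_EFinD => //; exact: kint.
  by apply: eq_Rintegral => s _; rewrite /Gw -/c2 /abel_kernel; ring.
(* By the sign in [rRLD], the derivative of [r] is minus the sum of the two right derivatives, so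
   the Euler-Lagrange equation says exactly that it equals [A + K]. *)
have dr t : a < t < b -> derivable r t 1 /\ derive1 r t = C t.
  move=> tab; have [dgv dhv] := dR t tab.
  have [dr1 dr2] := derive1_scaled_sum c1 dgv dhv.
  split; first exact: dr1.
  rewrite dr2.
  have tab' : a <= t <= b by case/andP: tab => /ltW-> /ltW->.
  have := EL t tab; rewrite /C /A KE// /rRLD -/c1 -/Lx -/lx.
  by lra.
have eta_b : eta b = 0 by rewrite /eta xbE ybE subrr.
have intv : \int[@lebesgue_measure R]_(t in `[a, b]) (Gv t * dv t) =
    - \int[@lebesgue_measure R]_(t in `[a, b]) (C t * eta t).
  rewrite -(fractional_integration_by_parts q0 ab fi etaE eta_b kfi cGv cC rE dr).
  by apply: eq_Rintegral => t; rewrite inE/= in_itv/= => /dvE ->.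
rewrite RintegralD//; [|exact: subint|exact: subint].
(* The integral of [Lz * Q] becomes that of [q * P]. *)
rewrite Rintegral_triangle//; last exact: subint.
have cqP : {within `[a, b], continuous (fun s => q s * P s)}.
  exact: (within_continuousM cq cP).
rewrite -RintegralD//; [|exact: subint|exact: subint].
have cAeta : {within `[a, b], continuous (fun s => A s * eta s)}.
  exact: (within_continuousM cA ceta).
have cKeta : {within `[a, b], continuous (fun s => K s * eta s)}.
  exact: (within_continuousM cK ceta).
have cGvdv : {within `[a, b], continuous (fun s => Gv s * dv s)}.
  exact: (within_continuousM cGv cdv).
have cGwdw : {within `[a, b], continuous (fun s => (gw s + hw s) * dw s)}.
  exact: (within_continuousM (within_continuousD cgw chw) cdw).
have -> : \int[@lebesgue_measure R]_(t in `[a, b]) (W t + q t * P t) =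
    \int[@lebesgue_measure R]_(t in `[a, b])
      (A t * eta t + Gv t * dv t + (gw t + hw t) * dw t).
  apply: eq_Rintegral => t _; rewrite /W /q /A /Gv /hv /hw -/lv -/lw.
  by ring.
rewrite RintegralD//; 
  [|exact: (subint _ _ bab (within_continuousD cAeta cGvdv))|exact: subint].
rewrite RintegralD//; [|exact: subint|exact: subint].
(* The three integrals are now those of [A * eta], of [- C * eta] and of [K * eta], which cancel
   since [C = A + K]. *)
rewrite intw intv.
have -> : \int[@lebesgue_measure R]_(t in `[a, b]) (C t * eta t) =
    \int[@lebesgue_measure R]_(t in `[a, b]) (A t * eta t) +
    \int[@lebesgue_measure R]_(t in `[a, b]) (K t * eta t).
  rewrite -RintegralD//; [|exact: subint|exact: subint].
  by apply: eq_Rintegral => t _; rewrite -mulrDl.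
by rewrite opprD addrA subrr add0r addNr.
Qed.
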